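(* Suppose $Y$ is exponentially distributed with mean $1/\beta$, $\beta>0$. Then for any $k \in \mathbb{N}$ there exists $C = C(k) > 0$ such that, for all $n \in \mathbb{N}$ (with $n\ge 1$) and all $x \ge 0$, $$\left| \psi_n(x) - \sum_{m=0}^{k} \frac{\varepsilon_n^m}{m!}\, \frac{\partial^m g}{\partial y^m}(x,0) \right| \le C \varepsilon_n^{k+1} = \frac{C}{n^{(k+1)/2}},$$ where $\varepsilon_n = n^{-1/2}$ and $g:[0,\infty)\times[0,1]\to\mathbb{R}$ is given by $$g(x,y) = \frac{1}{1+\theta y}\exp\left(-\frac{\theta\beta x}{1+\theta y}\right).$$
   Context: Setting: $\lambda > 0$, $\theta > 0$ and $\beta > 0$ are constants, and $Y_1, Y_2, \dots$ are i.i.d. copies of the claim size $Y$. The constant $C$ does not depend on $n$ or $x$ (it may depend on the fixed parameters of the model). Derivatives of $g$ in $y$ at $y=0$ are one-sided (right) derivatives. Scaled Cram\'er--Lundberg model: for $n > 0$, let $\lambda_n = n\lambda$, $c_n = (\sqrt{n} + \theta)\lambda\, \mathbb{E}Y$, let $N^{(n)} = \{N^{(n)}_t\}_{t\ge 0}$ be a homogeneous Poisson process with intensity $\lambda_n$, independent of $\{Y_i\}$, and for $x \ge 0$ let $$X^{(n)}_t = x + c_n t - \sum_{i=1}^{N^{(n)}_t} \frac{Y_i}{\sqrt{n}}, \quad t \ge 0.$$ The probability of (ultimate) ruin is $\psi_n(x) = \mathbb{P}(\tau_n < \infty \mid X_0^{(n)} = x)$, where $\tau_n = \inf\{t \ge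 0 : X^{(n)}_t < 0\}$. *)

(* Defs.v *)
From HB Require Import structures.
From mathcomp Require Import all_boot all_order all_algebra.
From mathcomp Require Import all_classical all_reals all_analysis.

Set Implicit Arguments.
Unset Strict Implicit.
Unset Printing Implicit Defensive.

Import Order.TTheory GRing.Theory Num.Theory.
Import numFieldNormedType.Exports.

Local Open Scope classical_set_scope.
Local Open Scope ring_scope.

Definition mutually_independent d d' (T : measurableType d)
    (T' : measurableType d') (R : realType) (P : probability T R)
    (I : choiceType) (X : I -> T -> T') : Prop :=
  forall (s : seq I) (B : I -> set T'), uniq s ->
    (forall i, measurable (B i)) ->
    P (\bigcap_(i in [set` s]) X i @^-1` B i) =
    (\prod_(i <- s) P (X i @^-1` B i))%E.

(* The sigma-algebra on T generated by the maps X i, i in D *)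
Definition generated_sigma_algebra d' (T : Type) (T' : measurableType d')
    (I : Type) (D : set I) (X : I -> T -> T') : set (set T) :=
  <<s \bigcup_(i in D) preimage_set_system setT (X i) measurable >>.

Definition independent_sigma_algebras d (T : measurableType d) (R : realType)
    (P : probability T R) (F G : set (set T)) : Prop :=
  forall A B, F A -> G B -> P (A `&` B) = (P A * P B)%E.

Definition has_exponential_law d (T : measurableType d) (R : realType)
    (P : probability T R) (beta : R) (X : {RV P >-> R}) : Prop :=
  forall B : set R, measurable B ->
    distribution P X B = exponential_prob beta B.

(* Only times t >= 0 are constrained. The truncated subtraction on nat is the
   true increment because the paths are nondecreasing. *)
Record poisson_process d (T : measurableType d) (R : realType)
    (P : probability T R) (rate : R) (N : R -> {RV P >-> nat}) : Prop := {
  poisson_process_start : forall w, N 0 w = 0%N;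
  poisson_process_nondecreasing :
    forall w (s t : R), 0 <= s -> s <= t -> (N s w <= N t w)%N;
  poisson_process_right_continuous :
    forall w (t : R), 0 <= t -> N s w @[s --> t^'+] --> N t w;
  poisson_process_independent_increments :
    forall t : nat -> R, 0 <= t 0%N -> (forall i, t i <= t i.+1) ->
      mutually_independent P (fun i w => (N (t i.+1) w - N (t i) w)%N);
  poisson_process_increment_law :
    forall s t : R, 0 <= s -> s < t -> forall j : nat,
      P [set w | (N t w - N s w)%N = j] =
      (poisson_pmf (rate * (t - s)) j)%:E
}.

(* c_n; the claims Y_1, Y_2, ... are Y 0, Y 1, ... *)
Definition premium_rate d (T : measurableType d) (R : realType)
    (P : probability T R) (lambda theta : R) (Y : nat -> {RV P >-> R})
    (n : nat) : R :=
  (Num.sqrt n%:R + theta) * lambda * fine ('E_P[Y 0%N])%E.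

Definition surplus d (T : measurableType d) (R : realType)
    (P : probability T R) (lambda theta : R) (Y : nat -> {RV P >-> R})
    (n : nat) (N : R -> {RV P >-> nat}) (x t : R) (w : T) : R :=
  x + premium_rate lambda theta Y n * t
  - \sum_(i < N t w) Y i w / Num.sqrt n%:R.

Definition ruin_time (T : Type) (R : realType) (X : R -> T -> R) (w : T) :
    \bar R :=
  ereal_inf [set t%:E | t in [set t : R | 0 <= t /\ X t w < 0]].

Definition ruin_probability d (T : measurableType d) (R : realType)
    (P : probability T R) (lambda theta : R) (Y : nat -> {RV P >-> R})
    (n : nat) (N : R -> {RV P >-> nat}) (x : R) : R :=
  fine (P [set w | (ruin_time (surplus lambda theta Y n N x) w < +oo)%E]).

Definition eps (R : realType) (n : nat) : R := n%:R `^ (- 2^-1).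

Definition g (R : realType) (theta beta x y : R) : R :=
  (1 + theta * y)^-1 * expR (- (theta * beta * x / (1 + theta * y))).

(* Derivative of a function on D: one-sided at the endpoints of an interval *)
Definition derive_within (R : realType) (D : set R) (f : R -> R) (y : R) : R :=
  lim ((f z - f y) / (z - y) @[z --> within D y^']).

(* The m-th partial derivative of g in y, g being a function on
   [0, +oo[ x [0, 1] *)
Definition dyg (R : realType) (theta beta : R) (m : nat) (x y : R) : R :=
  iter m (derive_within `[0, 1]) (g theta beta x) y.

(* Main.v *)
Require Import Defs.
From HB Require Import structures.
From mathcomp Require Import all_boot all_order all_algebra.
From mathcomp Require Import all_classical all_reals all_analysis.
From mathcomp Require Import measurable_realfun.
From mathcomp Require Import ring lra.

Set Implicit Arguments.
Unset Strict Implicit.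
Unset Printing Implicit Defensive.

Import Order.TTheory GRing.Theory Num.Theory.
Import numFieldNormedType.Exports.

Local Open Scope classical_set_scope.
Local Open Scope ring_scope.

(** The ruin probability is known exactly: for exponential claims
    psi_n(x) = g(x, eps_n), so the expansion is Taylor's formula for y |-> g(x, y)
    at y = 0, provided that the remainder is bounded uniformly in x >= 0.

    Uniform Taylor bound.  With u = 1 / (1 + theta y) and a = theta beta, one has
    g = u exp(- a x u).  Since u' = - theta u^2, each y-derivative of g is
    u^(m+1) p_m(x u) exp(- a x u) for a polynomial p_m that depends neither on x
    nor on y ([is_derive_g_derive]).  As u lies in ]0, 1] and p_m(s) exp(- a s) is
    bounded on s >= 0, all derivatives are bounded independently of x
    ([g_derive_bounded]).

    Exact ruin probability ([exponential_ruin_probability]).  After multiplication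
    by sqrt n the surplus is X_t = x + c t - (sum of N_t claims of law Exp(b)), with
    N of rate L and L < b c.  The claim is that ruin has probability
    phi(x) = L / (b c) * exp(- r x) with r = b - L / c.  Set phi(u) = 1 for u < 0.
    Jump times of N are avoided by watching X on the grid h, 2h, 3h and so on.
    Let G_k be the event that X is nonnegative at the first k grid times.  The
    increments of N and the later claims are independent of the past
    ([grid_independence]), and phi is chosen so that the mean of phi(y - claim) is
    exp(- r y) for y >= 0 ([ruin_fun_exp_law]).  Hence over one step, up to an error
    of order h^2 that comes from two or more claims in the same step, the mean of
    phi(X_(k+1)) on G_k equals the mean of phi(X_k) on G_k
    ([survival_recursion]).  Summing over k steps,
    P(not G_k) + E[phi(X_k); G_k] = phi(x) + O(k h^2) ([ruin_potential_balance]).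
    The second term dies out for large k h: for an exponent strictly between 0
    and r the same recursion contracts by exp(- delta h) at each step
    ([ruin_potential_decay]).  With h = 4^-p and k = 8^p, one has k h^2 = 2^-p and
    k h = 2^p, so P(not G_k) tends to phi(x) ([cvg_grid_ruin]).  By right
    continuity of the paths these events increase to the ruin event
    ([ruin_on_grid]), and continuity of the measure concludes. *)

(** * Derivatives of g in y, their uniform bound, and Taylor's formula *)

(** The recursion comes from differentiating u^(m+1) q(x u) with
    q(s) = p(s) exp(- a s) and u' = - theta u^2:
    the result is - theta u^(m+2) ((m+1) q + s q')(x u). *)
Definition g_derive_poly (R : realType) (theta a : R) (m : nat) : {poly R} :=
  iteri m (fun i p => - theta *: (p *+ i.+1 + 'X * (p^`() - a *: p))) 1.

Definition g_derive (R : realType) (theta beta : R) (m : nat) (x y : R) : R :=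
  let u := (1 + theta * y)^-1 in
  u ^+ m.+1 * (g_derive_poly theta (theta * beta) m).[x * u]
    * expR (- (theta * beta * (x * u))).

Lemma g_derive0 (R : realType) (theta beta x : R) : g_derive theta beta 0 x = g theta beta x.
Proof.
apply/funext => y; rewrite /g_derive /g /= hornerC expr1 mulr1.
by congr (_ * expR (- _)); rewrite mulrA.
Qed.

(** Each factor s of the polynomial is absorbed by half of the exponential rate,
    since s exp(- a s / 2) <= 2 / a; so the induction must run over all rates. *)
Lemma poly_expR_bounded (R : realType) (p : {poly R}) (a : R) : 0 < a ->
  exists M : R, forall s, 0 <= s -> `|p.[s]| * expR (- (a * s)) <= M.
Proof.
elim/poly_ind: p a => [|p c IH] a a0.
  by exists 0 => s _; rewrite horner0 normr0 mul0r.
have a20 : 0 < a / 2 by rewrite divr_gt0.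
have [M HM] := IH _ a20.
exists (M * (2 / a) + `|c|) => s s0.
rewrite hornerMXaddC.
have e1 : s * expR (- (a / 2 * s)) <= 2 / a.
  rewrite expRN ler_pdivrMr ?expR_gt0//.
  have /(ler_wpM2l _) := expR_ge1Dx (a / 2 * s).
  move=> /(_ (2 / a)) h; apply: le_trans (h _); last by rewrite divr_ge0// ltW.
  rewrite mulrDr mulr1 mulrA (_ : 2 / a * (a / 2) = 1) ?mul1r; last by field; rewrite gt_eqF.
  by rewrite lerDr divr_ge0// ltW.
have es : expR (- (a * s)) = expR (- (a / 2 * s)) * expR (- (a / 2 * s)).
  by rewrite -expRD; congr expR; field.
apply: (@le_trans _ _ ((`|p.[s]| * s + `|c|) * expR (- (a * s)))).
  rewrite ler_wpM2r ?expR_ge0//; apply: (le_trans (ler_normD _ _)).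
  by rewrite normrM (ger0_norm s0).
rewrite mulrDl lerD//; last first.
  by rewrite ler_piMr// expR_le1 oppr_le0 mulr_ge0// ltW.
rewrite es mulrACA ler_pM ?HM ?mulr_ge0 ?expR_ge0//.
Qed.

(** The bound does not depend on x because x occurs only through s = x u in
    p_m(s) exp(- a s), while the remaining factor u^(m+1) is at most 1. *)
Lemma g_derive_bounded (R : realType) (theta beta : R) (m : nat) :
  0 < theta -> 0 < beta ->
  exists M : R, forall x y, 0 <= x -> 0 <= y -> `|g_derive theta beta m x y| <= M.
Proof.
move=> t0 b0.
have [M HM] := poly_expR_bounded (g_derive_poly theta (theta * beta) m) (mulr_gt0 t0 b0).
exists M => x y x0 y0; rewrite /g_derive.
have ty : 0 <= theta * y by rewrite mulr_ge0// ltW.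
have u0 : 0 < 1 + theta * y by lra.
have iu0 : 0 <= (1 + theta * y)^-1 by rewrite invr_ge0 ltW.
rewrite -mulrA normrM [X in _ * X]normrM (ger0_norm (expR_ge0 _)).
apply: le_trans (HM _ (mulr_ge0 x0 iu0)).
rewrite ler_piMl ?mulr_ge0 ?expR_ge0// ger0_norm ?exprn_ge0//.
by rewrite exprn_ile1// invf_le1// lerDl.
Qed.

Lemma is_derive_g_derive (R : realType) (theta beta x y : R) (m : nat) :
  0 < 1 + theta * y ->
  is_derive y 1 (g_derive theta beta m x) (g_derive theta beta m.+1 x y).
Proof.
move=> u0.
set a := theta * beta; set p := g_derive_poly theta a m.
pose v := (cst 1 + theta \*: id : R -> R).
have vE z : v z = 1 + theta * z by [].
have vy : v y != 0 by rewrite vE gt_eqF.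
have dv : is_derive y 1 v theta.
  by apply: is_derive_eq; rewrite add0r scaler1.
have du := is_deriveV vy dv.
set u := (fun z => (v z)^-1) in du.
pose G := ((id ^+ m.+1) * (horner p \o (x \*: id)) * (expR \o (- (a * x) \*: id)) : R -> R).
have -> : g_derive theta beta m x = G \o u.
  apply/funext => z; rewrite /g_derive /= /G !fctE /u -vE /=.
  by rewrite /GRing.scale/= mulNr mulrA.
have dx (b w : R) : is_derive w 1 (b \*: id : R -> R) b.
  by apply: is_derive_eq; rewrite scaler1.
have dG (w : R) : is_derive w (1:R) G
    (w ^+ m * (m.+1%:R * p.[x * w] + x * w * (p^`().[x * w] - a * p.[x * w]))
     * expR (- (a * (x * w)))).
  rewrite /G; apply: is_derive_eq.
  rewrite !fctE /= /GRing.scale/= mulNr mulrA exprS.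
  have -> : a * x * w = a * (x * w) by rewrite mulrA.
  ring.
apply: is_derive_eq.
rewrite /u vE /g_derive -/a /= -/p !hornerE.
set U := (1 + theta * y)^-1.
rewrite exprVn -/U /GRing.scale/= [U ^+ m.+2]exprS [U ^+ m.+1]exprS hornerMn.
have -> : (1 + theta * y) ^- 2 = U ^+ 2 by rewrite exprVn.
have -> : (1 + theta * y) ^- m = U ^+ m by rewrite exprVn.
rewrite -[p.[_] *+ m.+1]mulr_natl.
ring.
Qed.

(** Every point of the segment, endpoints included, is a limit of other points
    of the segment; without this a limit along the filter would not be unique. *)
Lemma within_segment_proper (R : realType) (y : R) :
  0 <= y <= 1 -> ProperFilter (within `[0, 1] y^').
Proof.
move=> /andP[y0 y1]; apply: Build_ProperFilter_ex.
move=> P; rewrite /within/= /dnbhs /within/= => -[e /= e0 H].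
(* at most 1 / 2, so that y + t or y - t stays in the segment *)
pose t := Num.min e 1 / 2.
have t0 : 0 < t by rewrite divr_gt0// lt_min e0 ltr01.
have te : t < e.
  by rewrite /t ltr_pdivrMr// (@le_lt_trans _ _ e) ?ge_min ?lexx// ltr_pMr// ltr1n.
have t12 : t <= 1 / 2 by rewrite /t ler_pdivrMr// divfK// ge_min lexx orbT.
have [y2|y2] := leP y (1 / 2).
- exists (y + t); apply: H => /=.
  + by rewrite opprD addNKr normrN gtr0_norm.
  + by rewrite -subr_eq0 addrAC subrr add0r gt_eqF.
  + by rewrite in_itv/=; apply/andP; split; lra.
- exists (y - t); apply: H => /=.
  + by rewrite opprD opprK addNKr gtr0_norm.
  + by rewrite -subr_eq0 addrAC subrr add0r oppr_eq0 gt_eqF.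
  + by rewrite in_itv/=; apply/andP; split; lra.
Qed.

(** Only the values of F on the segment matter, which lets the iterated
    one-sided derivative be computed by induction although the previous iterate
    is known on the segment only. *)
Lemma derive_within_segmentE (R : realType) (f F : R -> R) (y df : R) :
  0 <= y <= 1 -> is_derive y 1 f df ->
  (forall z, 0 <= z <= 1 -> F z = f z) ->
  derive_within `[0, 1] F y = df.
Proof.
move=> y01 /is_derive1_caratheodory[q [fq cq <-]] Ff.
have FF := within_segment_proper y01.
rewrite /derive_within; apply: cvg_lim => //.
have cq' : q z @[z --> within `[0, 1] y^'] --> q y.
  by apply: cvg_within_filter; exact/continuous_withinNx.
apply: cvg_trans cq'; apply: near_eq_cvg.
near=> z.
have z01 : 0 <= z <= 1.
  have : `[0, 1]%classic z by near: z; exact: withinT.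
  by rewrite /= in_itv.
have zy : z != y by near: z; apply: cvg_within; apply: withinT.
by rewrite !Ff// fq /GRing.scale/= mulfK// subr_eq0.
Unshelve. all: by end_near. Qed.

Lemma dygE (R : realType) (theta beta x y : R) (m : nat) :
  0 < theta -> 0 <= y <= 1 ->
  dyg theta beta m x y = g_derive theta beta m x y.
Proof.
move=> t0; elim: m y => [|m IH] y y01; first by rewrite g_derive0.
apply: (@derive_within_segmentE _ (g_derive theta beta m x)) => //.
apply: is_derive_g_derive.
by case/andP: y01 => y0 _; rewrite ltr_pwDl// mulr_ge0// ltW.
Qed.

Definition taylor_poly (R : realType) (F : nat -> R -> R) (k : nat) : {poly R} :=
  \poly_(m < k) (F m 0 / m`!%:R).

Lemma deriv_taylor_poly (R : realType) (F : nat -> R -> R) (k : nat) :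
  (taylor_poly F k.+1)^`() = taylor_poly (fun m => F m.+1) k.
Proof.
apply/polyP => i; rewrite coef_deriv !coef_poly ltnS.
case: ifP => _; last by rewrite mul0rn.
have n0 : i.+1%:R != 0 :> R by rewrite pnatr_eq0.
by rewrite factS natrM -[LHS]mulr_natr invfM -!mulrA; congr (_ * _); rewrite mulrCA mulVf ?mulr1.
Qed.

(** The difference between F 0 and its Taylor polynomial vanishes at 0 and its
    derivative is the same difference for the shifted sequence; the mean value
    theorem turns a bound M c^k on the derivative into M e^(k+1). *)
Lemma taylor_remainder_le (R : realType) (F : nat -> R -> R) (k : nat) (M e : R) :
  0 <= e ->
  (forall m y, 0 <= y <= e -> is_derive y 1 (F m) (F m.+1 y)) ->
  (forall y, 0 <= y <= e -> `|F k y| <= M) ->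
  `|F 0%N e - (taylor_poly F k).[e]| <= M * e ^+ k.
Proof.
elim: k F e => [|k IH] F e e0 dF FM.
  have -> : taylor_poly F 0 = 0 by apply/polyP => i; rewrite coef_poly coef0.
  by rewrite horner0 subr0 expr0 mulr1 FM// e0 lexx.
pose h := F 0%N - horner (taylor_poly F k.+1).
pose dh t := F 1%N t - (taylor_poly (fun m => F m.+1) k).[t].
have dhP t : 0 <= t <= e -> is_derive t (1 : R) h (dh t).
  move=> te; have d0 := dF 0%N t te.
  by apply: is_derive_eq; rewrite deriv_taylor_poly.
have h0 : h 0 = 0.
  rewrite /h !fctE horner_poly big_ord_recl/= expr0 mulr1 divr1 big1 ?addr0 ?subrr// => i _.
  by rewrite expr0n/= mulr0.
have [||c ce] := @MVT_segment R h dh 0 e e0.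
- by move=> t; rewrite in_itv/= => /andP[t0 te]; apply: dhP; rewrite !ltW.
- apply: derivable_within_continuous => t; rewrite in_itv/= => te.
  by have [] := dhP t te.
rewrite h0 !subr0 => he.
move: ce; rewrite in_itv/= => /andP[c0 ce].
rewrite -[X in `|X|]/(h e) he normrM (ger0_norm e0) exprSr mulrA ler_wpM2r//.
have Mk : `|dh c| <= M * c ^+ k.
  apply: IH => // [m y|y] /andP[y0 yc].
  - by apply: dF; rewrite y0 (le_trans yc).
  - by apply: FM; rewrite y0 (le_trans yc).
apply: (le_trans Mk); rewrite ler_wpM2l//; last by rewrite lerXn2r// nnegrE.
by apply: le_trans (FM 0 _); rewrite ?normr_ge0// lexx.
Qed.

(** * The exponential distribution *)

(** The canonical probability structure of [exponential_prob b] takes a proof of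
    [0 < b] that unification cannot supply; this name carries that proof. *)
Definition exp_law (R : realType) (b : R) (b0 : 0 < b) :
    probability (measurableTypeR R) R :=
  exponential_distribution_exponential_prob__canonical__probability_measure_Probability
    b0.

(** The density is the Radon-Nikodym derivative, because both integrate to the
    same value over every measurable set. *)
Lemma ge0_integral_exponential_prob (R : realType) (b : R) (f : R -> \bar R) (b0 : 0 < b) :
  measurable_fun [set: R] f -> (forall x, 0 <= f x)%E ->
  (\int[exp_law b0]_x f x =
   \int[lebesgue_measure]_x (f x * (exponential_pdf b x)%:E))%E.
Proof.
move=> mf f0.
set nu := exp_law b0.
have mpdf : measurable_fun setT (EFin \o exponential_pdf b).
  by apply/measurable_EFinP; exact: measurable_exponential_pdf.
have dom : nu `<< (@lebesgue_measure R).
  apply/null_content_dominatesP => A mA A0.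
  rewrite /nu/= /exponential_prob; apply: null_set_integral => //.
  exact: measurable_funTS.
rewrite -[LHS](Radon_Nikodym_SigmaFinite.change_of_variables dom)//.
apply: ae_eq_integral => //.
- apply: emeasurable_funM => //.
  exact: measurable_int (Radon_Nikodym_SigmaFinite.f_integrable dom).
- exact: emeasurable_funM.
have : ae_eq lebesgue_measure setT
    (Radon_Nikodym_SigmaFinite.f nu lebesgue_measure) (EFin \o exponential_pdf b).
  apply: integral_ae_eq => //.
    exact: Radon_Nikodym_SigmaFinite.f_integrable.
  by move=> E _ mE; rewrite -Radon_Nikodym_SigmaFinite.f_integral.
by apply: filterS => x /(_ I) /= h _; rewrite h.
Qed.

Lemma exponential_prob_gt (R : realType) (b y : R) : 0 < b -> 0 <= y ->
  exponential_prob b `]y, +oo[ = (expR (- b * y))%:E.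
Proof.
move=> b0 y0; rewrite /exponential_prob.
have cexp : continuous (fun z : R => - expR (- b * z)).
  move=> z; apply: cvgN; apply: continuous_comp; last exact: continuous_expR.
  by apply: cvgM => //; exact: cvg_cst.
rewrite integral_itv_obnd_cbnd; last first.
  by apply/measurable_EFinP; apply: measurable_funTS; exact: measurable_exponential_pdf.
rewrite (@ge0_continuous_FTC2y _ _ (fun x => - (expR (- b * x))) _ 0)//.
- by rewrite sub0e EFinN oppeK.
- by move=> x _; apply: exponential_pdf_ge0; exact: ltW.
- apply: (@continuous_subspaceW R^o _ _ [set` `[0, +oo[%R]).
    by apply: subset_itvr; rewrite bnd_simp.
  exact: within_continuous_exponential_pdf.
- rewrite -oppr0; apply: cvgN.
  rewrite (_ : (fun x => expR (- b * x)) =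
               (fun z => expR (- z)) \o (fun z => b * z)); last first.
    by apply: eq_fun => x; rewrite mulNr.
  apply: (@cvg_comp _ _ _ _ _ _ (pinfty_nbhs R)); last exact: cvgr_expR.
  exact: gt0_cvgMry.
- by apply/cvg_at_right_filter; exact: cexp.
- move=> x; rewrite in_itv/= andbT => yx; apply: derive1_exponential_pdf.
  by rewrite in_itv/= andbT (le_lt_trans y0).
Qed.

(** Tilting the density of rate b by exp(s z) gives, up to the factor
    b / (b - s), the density of rate b - s. *)
Lemma truncated_mgf_exponential_prob (R : realType) (b s y : R) (b0 : 0 < b) :
  s < b -> 0 <= y ->
  (\int[exp_law b0]_(z in `[0%R, y]) (expR (s * z))%:E =
   (b / (b - s) * (1 - expR (- (b - s) * y)))%:E)%E.
Proof.
move=> sb y0.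
rewrite integral_mkcond ge0_integral_exponential_prob//; last 2 first.
- apply/measurable_restrict => //; apply: measurable_funTS.
  by apply/measurable_EFinP; apply: measurableT_comp => //.
- by move=> x; rewrite patchE; case: ifP => // _; rewrite lee_fin expR_ge0.
transitivity (\int[lebesgue_measure]_(z in `[0%R, y])
    ((b / (b - s))%:E * (exponential_pdf (b - s) z)%:E))%E.
  rewrite [RHS]integral_mkcond; apply: eq_integral => z _.
  rewrite !patchE; case: ifPn => [|_]; last by rewrite mul0e.
  rewrite inE/= in_itv/= => /andP[z0 _].
  rewrite -!EFinM !exponential_pdfE//; congr EFin.
  rewrite mulrCA [RHS]mulrA -[b / _ * _]mulrA mulVf ?subr_eq0 ?gt_eqF// mulr1.
  by rewrite -expRD; congr (_ * expR _); ring.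
have pdf0 : measurable_fun [set: R] (EFin \o exponential_pdf (b - s)).
  by apply/measurable_EFinP; exact: measurable_exponential_pdf.
have bs : 0 <= b - s by rewrite subr_ge0 ltW.
rewrite ge0_integralZl//; last 3 first.
- exact: measurable_funTS.
- by move=> x _; rewrite lee_fin exponential_pdf_ge0.
- by rewrite lee_fin divr_ge0// ltW.
rewrite [RHS]EFinM; congr (_ * _)%E.
move: y0; rewrite le_eqVlt => /orP[/eqP<-|y0].
  by rewrite set_itv1 integral_set1 mulr0 expR0 subrr.
exact: exponential_prob_itv0c.
Qed.

(** The tail formula for the expectation needs a nonnegative variable, and X is
    nonnegative only almost surely; hence the passage through its positive
    part. *)
Lemma mean_exponential (d : measure_display) (T : measurableType d) (R : realType)
    (P : probability T R) (b : R) (X : {RV P >-> R}) :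
  0 < b -> has_exponential_law b X -> ('E_P[X] = (b^-1)%:E)%E.
Proof.
move=> b0 HX.
have mXp : measurable_fun [set: T] (fun w => Num.max (X w) 0).
  by apply: measurable_maxr => //; exact: measurable_cst.
pose Xp : {RV P >-> R} := HB.pack (fun w => Num.max (X w) 0)
  (isMeasurableFun.Build _ _ _ _ _ mXp).
have -> : ('E_P[X] = 'E_P[Xp])%E.
  rewrite !expectation_def; apply: ae_eq_integral => //.
  - exact/measurable_EFinP.
  - exact/measurable_EFinP.
  (* the exceptional set where X and its positive part differ *)
  exists (X @^-1` `]-oo, 0[); split.
  - exact: measurable_funPTI.
  - have := HX `]-oo, 0[%classic; rewrite /distribution/= /pushforward => -> //.
    rewrite /exponential_prob; apply: integral0_eq => x; rewrite /= in_itv/= => x0.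
    by rewrite lt0_exponential_pdf.
  move=> w /= h; rewrite in_itv/= ltNge; apply/negP => w0; apply: h => _.
  by rewrite /Xp /= max_l.
rewrite ge0_expectation_ccdf; last by move=> w; rewrite /Xp/= le_max lexx orbT.
transitivity (\int[lebesgue_measure]_(r in `[0%R, +oo[) ((b^-1)%:E * (exponential_pdf b r)%:E))%E.
  apply: eq_integral => r; rewrite inE/= in_itv/= andbT => r0.
  rewrite exponential_pdfE// -EFinM mulKf ?gt_eqF//.
  rewrite -exponential_prob_gt// -HX//.
  have r0F : (r < 0) = false by rewrite ltNge r0.
  by congr (P _); apply/seteqP; split => w /=; rewrite !in_itv/= !andbT /Xp/= lt_max r0F orbF.
have mpdf : measurable_fun setT (EFin \o exponential_pdf b).
  by apply/measurable_EFinP; exact: measurable_exponential_pdf.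
rewrite ge0_integralZl//; last 3 first.
- exact: measurable_funTS.
- by move=> x _; rewrite lee_fin exponential_pdf_ge0// ltW.
- by rewrite lee_fin invr_ge0 ltW.
rewrite (_ : (\int[_]_(_ in _) _)%E = 1%E) ?mule1//.
rewrite -(integral_exponential_pdf b0) integral_mkcond; apply: eq_integral => x _.
rewrite patchE; case: ifPn => //; rewrite notin_setE/= in_itv/= andbT => /negP.
by rewrite -ltNge => x0; rewrite lt0_exponential_pdf.
Qed.

(** * Integrals on an event and independence *)

(** The complement of A is null for the restricted measure. *)
Lemma ge0_integral_mrestr (d : measure_display) (T : measurableType d) (R : realType)
    (mu : {measure set T -> \bar R}) (A : set T) (mA : measurable A) (f : T -> \bar R) :
  measurable_fun [set: T] f -> (forall x, 0 <= f x)%E ->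
  (\int[mrestr mu mA]_x f x = \int[mu]_(x in A) f x)%E.
Proof.
move=> mf f0.
rewrite -(setUv A) ge0_integral_setU//=; last 3 first.
- exact: measurableC.
- by rewrite setUv.
- exact/disj_setPCl.
rewrite [X in (_ + X)%E](_ : _ = 0%E) ?adde0; last first.
  apply: null_set_integral => //; first exact: measurableC.
    exact: measurable_funTS.
  by rewrite /= /mrestr setICl measure0.
apply: eq_measure_integral => B mB BA.
by rewrite /= /mrestr setIidl.
Qed.

(** The law of f on the event A has total mass P A, hence only the structure of a
    finite measure. *)
Section law_on.
Context (d d' : measure_display) (T : measurableType d) (T' : measurableType d')
  (R : realType) (P : probability T R) (A : set T) (mA : measurable A)
  (f : {mfun T >-> T'}).

Definition law_on : set T' -> \bar R := pushforward (mrestr P mA) f.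

Let law_on0 : law_on set0 = 0%E.
Proof. exact: measure0. Qed.

Let law_on_ge0 B : (0 <= law_on B)%E.
Proof. exact: measure_ge0. Qed.

Let law_on_sigma_additive : semi_sigma_additive law_on.
Proof. exact: measure_semi_sigma_additive. Qed.

HB.instance Definition _ := isMeasure.Build _ _ _ law_on
  law_on0 law_on_ge0 law_on_sigma_additive.

Let law_on_fin_num : fin_num_fun law_on.
Proof.
move=> B mB; rewrite /law_on /pushforward; apply: fin_num_measure.
exact: measurable_funPTI.
Qed.

HB.instance Definition _ := Measure_isFinite.Build _ _ _ law_on law_on_fin_num.

End law_on.

Lemma ge0_integral_law_on (d d' : measure_display) (T : measurableType d)
    (T' : measurableType d') (R : realType) (P : probability T R) (A : set T)
    (mA : measurable A) (f : {mfun T >-> T'}) (F : T' -> \bar R) :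
  measurable_fun [set: T'] F -> (forall x, 0 <= F x)%E ->
  (\int[law_on P mA f]_y F y = \int[P]_(x in A) F (f x))%E.
Proof.
move=> mF F0; rewrite ge0_integral_pushforward// preimage_setT ge0_integral_mrestr//.
  exact: measurableT_comp.
by move=> x; exact: F0.
Qed.

(** When V has law m and is independent of U on the event A, the joint law on A is
    a product measure, so that V can be integrated out first. *)
Lemma ge0_integral_indep (d d1 d2 : measure_display) (T : measurableType d)
    (T1 : measurableType d1) (T2 : measurableType d2) (R : realType)
    (P : probability T R) (m : probability T2 R) (A : set T)
    (U : {mfun T >-> T1}) (V : {mfun T >-> T2}) (F : T1 * T2 -> \bar R) :
  measurable A ->
  (forall B1 B2, measurable B1 -> measurable B2 ->
    P (A `&` U @^-1` B1 `&` V @^-1` B2) = P (A `&` U @^-1` B1) * m B2)%E ->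
  measurable_fun [set: T1 * T2] F -> (forall z, 0 <= F z)%E ->
  (\int[P]_(w in A) F (U w, V w) =
   \int[P]_(w in A) \int[m]_y F (U w, y))%E.
Proof.
move=> mA H mF F0.
have mUV : measurable_fun [set: T] (fun w => (U w, V w)).
  exact: measurable_fun_pair.
pose UV : {mfun T >-> (T1 * T2)%type} := HB.pack (fun w => (U w, V w))
  (isMeasurableFun.Build _ _ _ _ _ mUV).
rewrite -(ge0_integral_law_on P mA UV mF F0).
transitivity (\int[(law_on P mA U) \x m]_z F z)%E.
  apply: eq_measure_integral => B mB _; apply/esym.
  apply: product_measure_unique => // B1 B2 mB1 mB2.
  rewrite /= /law_on /pushforward /mrestr setIC [X in (_ = P X * _)%E]setIC -H//.
  by congr (P _); apply/seteqP; split => w //=; rewrite /UV/=; tauto.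
rewrite fubini_tonelli1//.
rewrite (@ge0_integral_law_on _ _ _ _ _ P A mA U (fun x => \int[m]_y F (x, y))%E)//.
- exact: measurable_fun_fubini_tonelli_F.
- by move=> x; apply: integral_ge0.
Qed.

Lemma ge0_integral_scaled_law (d d1 : measure_display) (T : measurableType d)
    (T1 : measurableType d1) (R : realType)
    (P : probability T R) (p : R) (A G : set T)
    (U : {mfun T >-> T1}) (F : T1 -> \bar R) :
  measurable A -> measurable G -> 0 <= p ->
  (forall B, measurable B -> P (A `&` U @^-1` B) = p%:E * P (G `&` U @^-1` B))%E ->
  measurable_fun [set: T1] F -> (forall z, 0 <= F z)%E ->
  (\int[P]_(w in A) F (U w) = p%:E * \int[P]_(w in G) F (U w))%E.
Proof.
move=> mA mG p0 H mF F0.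
rewrite -(ge0_integral_law_on P mA U mF F0) -(ge0_integral_law_on P mG U mF F0).
rewrite -[p]/((NngNum p0)%:num) -ge0_integral_mscale//.
apply: eq_measure_integral => B mB _.
rewrite /= /law_on /pushforward /mrestr /mscale/=.
by rewrite setIC H// setIC.
Qed.

(** * Independence of successive claims *)

Lemma measure_fibers (d : measure_display) (T : measurableType d) (R : realType)
    (P : probability T R) (f : T -> nat) (A : set T) :
  (forall q, measurable (f @^-1` [set q])) -> measurable A ->
  (P A = \sum_(q <oo) P (A `&` f @^-1` [set q]))%E.
Proof.
move=> mf mA; rewrite -measure_semi_bigcup; first last.
- by apply: bigcup_measurable => q _; exact: measurableI.
- by move=> i j _ _ [w [[_ +] [_]]]; rewrite /= => -> ->.
- by move=> q; exact: measurableI.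
congr (P _); apply/seteqP; split => [w Aw|w [q _ []]//].
by exists (f w).
Qed.

(** Conditioning on a discrete observable: applied to the numbered histories of
    jump counts. *)
Lemma eq_measure_fibers (d : measure_display) (T : measurableType d) (R : realType)
    (P : probability T R) (f : T -> nat) (A B : set T) (a : R) :
  (forall q, measurable (f @^-1` [set q])) -> measurable A -> measurable B ->
  (forall q, P (A `&` f @^-1` [set q]) = a%:E * P (B `&` f @^-1` [set q]))%E ->
  (P A = a%:E * P B)%E.
Proof.
move=> mf mA mB H.
rewrite (measure_fibers P mf mA) (measure_fibers P mf mB).
rewrite -nneseriesZl//; by apply: eq_eseriesr => q _.
Qed.

Lemma measurable_fun_random_index (d d' : measure_display) (T : measurableType d)
    (T' : measurableType d') (f : nat -> T -> T') (N : T -> nat) :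
  (forall l, measurable_fun [set: T] (f l)) -> measurable_fun [set: T] N ->
  measurable_fun [set: T] (fun w => f (N w) w).
Proof.
move=> mf mN _ B mB; rewrite setTI.
rewrite (_ : _ @^-1` B = \bigcup_l (N @^-1` [set l] `&` f l @^-1` B)); last first.
  apply/seteqP; split => [w Bw|w [l _ []]/= -> //].
  by exists (N w).
apply: bigcup_measurable => l _; apply: measurableI.
- by rewrite -[X in measurable X]setTI; exact: mN.
- by rewrite -[X in measurable X]setTI; exact: mf.
Qed.

Lemma measurable_fun_generated (d d' : measure_display) (T : measurableType d)
    (T' : measurableType d') (I : Type) (D : set I) (X : I -> T -> T') (i : I) :
  D i ->
  measurable_fun
    [set: g_sigma_algebraType (\bigcup_(i in D) preimage_set_system setT (X i) measurable)]
    (X i).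
Proof.
move=> Di _ B mB; apply: sub_sigma_algebra.
by exists i => //; exists B.
Qed.

Lemma generated_sigma_algebraS (d d' : measure_display) (T : measurableType d)
    (T' : measurableType d') (I : Type) (D D' : set I) (X : I -> T -> T') :
  D `<=` D' -> generated_sigma_algebra D X `<=` generated_sigma_algebra D' X.
Proof.
move=> DD'; apply: sub_sigma_algebra2 => E [i Di HE].
by exists i => //; exact: DD'.
Qed.

(** The finite-dimensional cylinders over the first l variables form a pi-system
    on which the product rule is the independence hypothesis; uniqueness of
    measures extends it to the sigma-algebra that they generate. *)
Lemma mutually_independent_next (d d' : measure_display) (T : measurableType d)
    (T' : measurableType d') (R : realType) (P : probability T R)
    (Y : nat -> {RV P >-> T'}) (l : nat) (D : set T) (B : set T') :
  mutually_independent P Y -> generated_sigma_algebra [set i | (i < l)%N] Y D ->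
  measurable B ->
  (P (D `&` Y l @^-1` B) = P D * P (Y l @^-1` B))%E.
Proof.
move=> HY GD mB.
pose cyl (C : nat -> set T') := \bigcap_(i in [set` iota 0 l]) Y i @^-1` C i.
pose G := [set E | exists2 C, (forall i, measurable (C i)) & E = cyl C].
have GT : G setT.
  by exists (fun=> setT) => //; apply/seteqP; split.
have mE : measurable (Y l @^-1` B) by exact: measurable_funPTI.
have mG : G `<=` measurable.
  by move=> _ [C mC ->]; apply: bigcap_measurableType => i _; exact: measurable_funPTI.
have p0 : (0 <= fine (P (Y l @^-1` B))) by rewrite fine_ge0.
suff : forall E, <<s G >> E -> (mrestr P mE E = mscale (NngNum p0) P E)%E.
  move=> /(_ D) H; have -> : (P (D `&` Y l @^-1` B) = mrestr P mE D)%E by [].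
  rewrite H; last first.
    apply: sub_sigma_algebra2 GD => E [i il [C mC <-]].
    exists (fun j => if j == i then C else setT).
      by move=> j; case: ifP.
    rewrite setTI; apply/seteqP; split => w.
    - by move=> Cw j _ /=; case: ifP => // /eqP ->.
    - by move=> /(_ i); rewrite /= mem_iota/= eqxx; apply.
  by rewrite /mscale/= fineK ?fin_num_measure// muleC.
apply: (g_sigma_algebra_measure_unique G mG (fun=> setT)) => //.
- by apply/seteqP; split => // w _; exists 0%N.
- move=> _ _ [C mC ->] [C' mC' ->]; exists (fun i => C i `&` C' i).
    by move=> i; exact: measurableI.
  by rewrite /cyl -bigcapI; apply: eq_bigcapr => i _; rewrite preimage_setI.
- move=> _ [C mC ->]; rewrite /= /mscale /mrestr /= fineK ?fin_num_measure//.
  have key (C' : nat -> set T') : (forall i, measurable (C' i)) ->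
      P (cyl C' `&` Y l @^-1` B) = (\prod_(i <- iota 0 l) P (Y i @^-1` C' i) * P (Y l @^-1` B))%E.
    move=> mC'; pose C2 i := if i == l then B else C' i.
    have := HY (rcons (iota 0 l) l) C2.
    rewrite rcons_uniq mem_iota iota_uniq/= add0n ltnn/= => /(_ isT).
    move=> H; have := H _; rewrite big_rcons/= /C2 eqxx.
    rewrite (_ : \bigcap_(i in _) _ = cyl C' `&` Y l @^-1` B); last first.
      apply/seteqP; split => w.
      - move=> Hw; split.
          move=> i /= il; have := Hw i; rewrite /= mem_rcons inE il orbT => /(_ isT).
          by rewrite ltn_eqF//; move: il; rewrite mem_iota.
        by have := Hw l; rewrite /= mem_rcons inE eqxx => /(_ isT).
      - move=> [Hw Hl] i /=; rewrite mem_rcons inE => /orP[/eqP->|il].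
          by rewrite eqxx.
        have -> : (i == l) = false by rewrite ltn_eqF//; move: il; rewrite mem_iota.
        exact: Hw.
    move=> ->; last by move=> i; case: ifP.
    congr (_ * _)%E; apply: eq_big_seq => i; rewrite mem_iota add0n => /andP[_ il].
    by rewrite ltn_eqF.
  rewrite key// muleC; congr (_ * _)%E.
  by have := HY (iota 0 l) C; rewrite iota_uniq => ->.
- by move=> k; rewrite /= /mrestr setTI (le_lt_trans (probability_le1 _ _))// ltry.
Qed.

(** * The surplus on a time grid *)

(** The scaled surplus multiplied by sqrt n has this form, with claims of law
    Exp(beta) whatever n is. *)
Definition risk (T : Type) (R : realType) (c x : R) (Y : nat -> T -> R)
    (N : R -> T -> nat) (t : R) (w : T) : R :=
  x + c * t - \sum_(i < N t w) Y i w.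

Section grid.
Context (d : measure_display) (T : measurableType d) (R : realType)
  (P : probability T R) (b L c : R) (Y : nat -> {RV P >-> R})
  (N : R -> {RV P >-> nat}) (x h : R).
Hypotheses (indepY : mutually_independent P Y)
  (lawY : forall i, has_exponential_law b (Y i))
  (poissonN : poisson_process L N)
  (indepNY : independent_sigma_algebras P
    (generated_sigma_algebra [set t : R | 0 <= t] N)
    (generated_sigma_algebra [set: nat] Y))
  (h0 : 0 < h).

Let S (l : nat) (w : T) : R := \sum_(i < l) Y i w.

Definition grid_risk (k : nat) (w : T) : R := risk c x Y N (h * k%:R) w.

Definition survival (k : nat) : set T :=
  [set w | forall i, (i <= k)%N -> 0 <= grid_risk i w].

Definition jumps (k : nat) (w : T) : nat := (N (h * k.+1%:R) w - N (h * k%:R) w)%N.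

(** The first claim that is not yet accounted for at the k-th grid time. *)
Definition next_claim (k : nat) (w : T) : R := Y (N (h * k%:R) w) w.

Definition jump_history (k : nat) (w : T) : seq nat := mkseq (jumps ^~ w) k.

Let grid_ge0 k : 0 <= h * k%:R :> R.
Proof. by rewrite mulr_ge0// ltW. Qed.

Lemma jump_historyS k w :
  jump_history k.+1 w = rcons (jump_history k w) (jumps k w).
Proof. by rewrite /jump_history /mkseq -addn1 iotaD map_cat /= add0n cats1. Qed.

Lemma N_jump_history k w : N (h * k%:R) w = sumn (jump_history k w).
Proof.
elim: k => [|k IH]; first by rewrite mulr0 (poisson_process_start poissonN).
rewrite jump_historyS sumn_rcons -IH /jumps subnKC//.
by apply: (poisson_process_nondecreasing poissonN) => //; rewrite ler_pM2l// ler_nat.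
Qed.

Lemma measurable_jumps k : measurable_fun [set: T] (jumps k).
Proof. exact: measurable_fun_subn. Qed.

Lemma jump_history_rcons k m v :
  [set w | jump_history k.+1 w = rcons v m] =
  [set w | jump_history k w = v] `&` jumps k @^-1` [set m].
Proof.
apply/seteqP; split => w /=; rewrite jump_historyS.
  by move=> /eqP; rewrite eqseq_rcons => /andP[/eqP -> /eqP ->].
by move=> [-> ->].
Qed.

Lemma jump_historyE k v : size v = k ->
  [set w | jump_history k w = v] =
  \bigcap_(i in [set` iota 0 k]) jumps i @^-1` [set nth 0%N v i].
Proof.
move=> sv; apply/seteqP; split => w /=.
  by move=> <- i /=; rewrite mem_iota add0n => /andP[_ ik]; rewrite nth_mkseq.
move=> H; apply: (@eq_from_nth _ 0%N); first by rewrite size_mkseq.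
move=> i; rewrite size_mkseq => ik; rewrite nth_mkseq//.
by apply: H; rewrite /= mem_iota.
Qed.

Lemma jump_history_size k v : size v != k -> [set w | jump_history k w = v] = set0.
Proof.
by move=> sv; apply/seteqP; split => w //= H; move: sv; rewrite -H size_mkseq eqxx.
Qed.

Lemma jump_history_generated k v :
  generated_sigma_algebra [set t : R | 0 <= t] N [set w | jump_history k w = v].
Proof.
have [sv|sv] := eqVneq (size v) k; last first.
  by rewrite jump_history_size//; exact: sigma_algebra0.
rewrite jump_historyE//.
set G := \bigcup_(t in [set t : R | 0 <= t]) preimage_set_system setT (N t) measurable.
have : measurable (\bigcap_(i in [set` iota 0 k]) jumps i @^-1` [set nth 0%N v i]
    : set (g_sigma_algebraType G)); last by [].
apply: bigcap_measurableType => i _.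
rewrite -[X in measurable X]setTI.
have mN j : measurable_fun [set: g_sigma_algebraType G] (N (h * j%:R)).
  exact: (@measurable_fun_generated _ _ T _ R [set t : R | 0 <= t] (fun t => N t) _ (grid_ge0 j)).
by apply: (measurable_fun_subn (mN i.+1) (mN i)).
Qed.

(** Both histories are finite-dimensional events of the increments; the product
    rule for k+1 increments splits off the last factor from the rule for k. *)
Lemma jump_history_indep k m v : size v = k ->
  (P [set w | jump_history k.+1 w = rcons v m] =
   P [set w | jump_history k w = v] * P (jumps k @^-1` [set m]))%E.
Proof.
move=> sv; rewrite !jump_historyE ?size_rcons ?sv//.
have t0 : 0 <= (fun i => h * i%:R) 0%N by [].
have tS i : (fun i => h * i%:R) i <= (fun i => h * i%:R) i.+1 :> R.
  by rewrite ler_pM2l// ler_nat.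
have H := poisson_process_independent_increments poissonN t0 tS.
have := H (iota 0 k.+1) (fun i => [set nth 0%N (rcons v m) i]).
rewrite iota_uniq => -> //.
have := H (iota 0 k) (fun i => [set nth 0%N v i]).
rewrite iota_uniq => -> //.
rewrite -addn1 iotaD big_cat/= add0n big_seq1; congr (_ * _)%E.
  apply: eq_big_seq => i; rewrite mem_iota add0n => /andP[_ ik].
  by rewrite nth_rcons sv ik.
by rewrite nth_rcons sv ltnn eqxx.
Qed.

Lemma measurable_claims l : measurable_fun [set: T] (S l).
Proof. exact: measurable_sum. Qed.

Lemma measurable_risk t : measurable_fun [set: T] (risk c x Y N t).
Proof.
apply: measurable_funB => //.
exact: (@measurable_fun_random_index _ _ T _ S (N t) measurable_claims).
Qed.

Lemma measurable_next_claim k : measurable_fun [set: T] (next_claim k).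
Proof.
exact: (@measurable_fun_random_index _ _ T _ (fun l => Y l) (N (h * k%:R))).
Qed.

Lemma measurable_survival k : measurable (survival k).
Proof.
rewrite (_ : survival k = \bigcap_(i in [set i | (i <= k)%N]) (grid_risk i @^-1` `[0, +oo[)).
  apply: bigcap_measurableType => i _; rewrite -[X in measurable X]setTI.
  exact: measurable_risk.
apply/seteqP; split => w H i /= ik; have := H i ik.
  by rewrite /= in_itv/= andbT.
by rewrite /= in_itv/= andbT.
Qed.

Let history_event (k : nat) (v : seq nat) (B : set R) : set T :=
  [set w | forall i, (i <= k)%N -> 0 <= x + c * (h * i%:R) - S (sumn (take i v)) w]
  `&` [set w | B (x + c * (h * k%:R) - S (sumn v) w)].

Let history_event_generated k v B : measurable B ->
  generated_sigma_algebra [set i | (i < sumn v)%N] Y (history_event k v B).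
Proof.
move=> mB.
set G := \bigcup_(i in [set i | (i < sumn v)%N]) preimage_set_system setT (Y i) measurable.
have mS l a : (l <= sumn v)%N ->
    measurable_fun [set: g_sigma_algebraType G] (fun w => a - S l w).
  move=> lv; apply: measurable_funB => //.
  rewrite (_ : S l = fun w => \sum_(i <- iota 0 l)
      (if (i < sumn v)%N then Y i w else 0)); last first.
    apply/funext => w; rewrite /S -(big_mkord xpredT (fun i => Y i w)) /index_iota subn0.
    apply: eq_big_seq => i; rewrite mem_iota add0n => /andP[_ il].
    by rewrite (leq_trans il lv).
  apply: measurable_sum => i.
  have [iv|iv] := ltnP i (sumn v); last exact: measurable_cst.
  exact: (@measurable_fun_generated _ _ T _ nat [set i | (i < sumn v)%N] (fun i => Y i) _ iv).
have : measurable (history_event k v B : set (g_sigma_algebraType G)); last by [].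
rewrite /history_event; apply: measurableI; last first.
  by have := mS (sumn v) (x + c * (h * k%:R)) (leqnn _) measurableT _ mB; rewrite setTI.
rewrite (_ : [set w | _] = \bigcap_(i in [set i | (i <= k)%N])
  ((fun w => x + c * (h * i%:R) - S (sumn (take i v)) w) @^-1` `[0, +oo[)); last first.
  apply/seteqP; split => w H i /= ik; have := H i ik.
    by rewrite /= in_itv/= andbT.
  by rewrite /= in_itv/= andbT.
apply: bigcap_measurableType => i _; rewrite -[X in measurable X]setTI.
apply: (mS (sumn (take i v))) => //.
by rewrite -{2}(cat_take_drop i v) sumn_cat leq_addr.
Qed.

Let survival_history k v B :
  survival k `&` grid_risk k @^-1` B `&` [set w | jump_history k w = v] =
  [set w | jump_history k w = v] `&` history_event k v B.
Proof.
have tk w i : jump_history k w = v -> (i <= k)%N -> jump_history i w = take i v.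
  by move=> <- ik; rewrite /jump_history /mkseq -map_take take_iota (minn_idPl ik).
apply/seteqP; split => w.
- move=> [[H1 H2] Hv]; split => //; split.
    by move=> i ik; have := H1 i ik; rewrite /grid_risk /risk N_jump_history (tk w i).
  by move: H2; rewrite /grid_risk /risk /= N_jump_history Hv.
- move=> [Hv [H1 H2]]; split => //; split.
    by move=> i ik; have := H1 i ik; rewrite /grid_risk /risk N_jump_history (tk w i).
  by move: H2; rewrite /grid_risk /risk /= N_jump_history Hv.
Qed.

(** Markov property of the surplus on the grid.  Once the history of jump counts is
    fixed, survival and the current surplus are events of the claims already
    paid, so that the independence of N and Y, of the increments of N and of the
    claims separates the four events. *)
Lemma grid_independence k m B1 B2 : measurable B1 -> measurable B2 ->
  (P (survival k `&` jumps k @^-1` [set m] `&` grid_risk k @^-1` B1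
      `&` next_claim k @^-1` B2) =
   P (jumps k @^-1` [set m]) * exponential_prob b B2
   * P (survival k `&` grid_risk k @^-1` B1))%E.
Proof.
move=> mB1 mB2.
have mJ j i : measurable (jumps j @^-1` [set i]).
  by rewrite -[X in measurable X]setTI; exact: measurable_jumps.
have mX : measurable (grid_risk k @^-1` B1).
  by rewrite -[X in measurable X]setTI; exact: measurable_risk.
have mZ : measurable (next_claim k @^-1` B2).
  by rewrite -[X in measurable X]setTI; exact: measurable_next_claim.
have mY l : measurable (Y l @^-1` B2) by exact: measurable_funPTI.
have expE l : exponential_prob b B2 = P (Y l @^-1` B2) by rewrite -(lawY l).
rewrite (expE 0%N).
rewrite -(fineK (fin_num_measure P _ (mJ k m))) -(fineK (fin_num_measure P _ (mY 0%N))).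
rewrite -EFinM.
have mhist v : measurable [set w | jump_history k w = v].
  have [sv|sv] := eqVneq (size v) k; last by rewrite jump_history_size.
  by rewrite jump_historyE//; apply: bigcap_measurableType.
(* the histories are countably many, and pickle numbers them *)
pose f w := pickle (jump_history k w).
have fE v : f @^-1` [set pickle v] = [set w | jump_history k w = v].
  apply/seteqP; split => w; rewrite /f /=; last by move=> ->.
  by move/(pcan_inj pickleK).
have f0 q : (forall v : seq nat, size v = k -> pickle v != q) -> f @^-1` [set q] = set0.
  move=> H; apply/seteqP; split => w //= fw.
  by have := H (jump_history k w); rewrite size_mkseq -fw /f eqxx => /(_ erefl).
have fcase q : (exists2 v : seq nat, size v = k & q = pickle v) \/ f @^-1` [set q] = set0.
  have [[v sv vq]|H] := pselect (exists2 v : seq nat, size v = k & q = pickle v).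
    by left; exists v.
  right; apply: f0 => v sv; apply/eqP => vq; apply: H; by exists v.
apply: (@eq_measure_fibers _ _ _ P f).
- by move=> q; have [[v sv ->]|->//] := fcase q; rewrite fE.
- apply: measurableI => //; apply: measurableI => //; apply: measurableI => //.
  exact: measurable_survival.
- by apply: measurableI => //; exact: measurable_survival.
move=> q; have [[v sv ->]|->] := fcase q; last by rewrite !setI0 measure0 mule0.
rewrite fE survival_history.
rewrite (_ : _ `&` [set w | jump_history k w = v] =
  [set w | jump_history k.+1 w = rcons v m] `&`
  (history_event k v B1 `&` Y (sumn v) @^-1` B2)); last first.
  rewrite jump_history_rcons setIA [X in _ = X `&` _]setIAC -survival_history.
  apply/seteqP; split => w.
    move=> [[[[H1 H2] H3] H4] H5]; split => //.
    by move: H4; rewrite /next_claim /= N_jump_history H5.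
  move=> [[[[H1 H2] H5] H3] H4]; split => //; split => //.
  by move: H4; rewrite /next_claim /= N_jump_history H5.
have DY : generated_sigma_algebra [set: nat] Y (history_event k v B1).
  have sub : [set i | (i < sumn v)%N] `<=` [set: nat] by [].
  exact: (@generated_sigma_algebraS _ _ T _ nat _ _ (fun i => Y i) sub _
    (@history_event_generated k v B1 mB1)).
have YY : generated_sigma_algebra [set: nat] Y (Y (sumn v) @^-1` B2).
  apply: sub_sigma_algebra; exists (sumn v) => //.
  by exists B2 => //; rewrite setTI.
rewrite indepNY; last 2 first.
- exact: jump_history_generated.
- set G := \bigcup_(i in [set: nat]) preimage_set_system setT (Y i) measurable.
  by apply: (@measurableI _ (g_sigma_algebraType G)).
rewrite (mutually_independent_next indepY (@history_event_generated k v B1 mB1) mB2).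
rewrite -expE (expE 0%N) indepNY//; last exact: jump_history_generated.
rewrite jump_history_indep// EFinM !fineK ?fin_num_measure//.
by rewrite muleACA muleC.
Qed.

End grid.

(** * Test functions that reproduce under an exponential claim *)

(** For s = b - L / c the prefactor is L / (b c) and this is the ruin probability
    as a function of the capital u.  The prefactor (b - s) / b makes
    [ruin_fun_exp_law] hold for every s. *)
Definition ruin_fun (R : realType) (b s u : R) : R :=
  if u < 0 then 1 else (b - s) / b * expR (- s * u).

Lemma measurable_ruin_fun (R : realType) (b s : R) :
  measurable_fun [set: R] (ruin_fun b s).
Proof.
apply: measurable_fun_if => //.
- exact: measurable_fun_ltr.
- apply: measurable_funTS; apply: measurable_funM => //.
  by apply: measurableT_comp => //; exact: measurable_funM.
Qed.

Lemma ruin_fun_ge0 (R : realType) (b s u : R) : 0 < b -> s < b -> 0 <= ruin_fun b s u.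
Proof.
move=> b0 sb; rewrite /ruin_fun; case: ifP => // _.
by rewrite mulr_ge0 ?expR_ge0// divr_ge0 ?subr_ge0// ltW.
Qed.

Lemma ruin_fun_le1 (R : realType) (b s u : R) : 0 < b -> 0 <= s -> s < b -> ruin_fun b s u <= 1.
Proof.
move=> b0 s0 sb; rewrite /ruin_fun; case: ltP => // u0.
rewrite mulr_ile1 ?expR_ge0//.
- by rewrite divr_ge0 ?subr_ge0// ltW.
- by rewrite ler_pdivrMr// mul1r gerBl.
- by rewrite expR_le1 mulNr oppr_le0 mulr_ge0.
Qed.

Lemma ge0_integral_exp_law_split (R : realType) (b y : R) (b0 : 0 < b) (f : R -> \bar R) :
  0 <= y -> measurable_fun [set: R] f -> (forall z, 0 <= f z)%E ->
  (\int[exp_law b0]_z f z =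
   \int[exp_law b0]_(z in `[0%R, y]) f z + \int[exp_law b0]_(z in `]y, +oo[) f z)%E.
Proof.
move=> y0 mf f0.
have neg : (\int[exp_law b0]_(z in `]-oo, 0%R[) f z = 0)%E.
  apply: null_set_integral => //; first exact: measurable_funTS.
  rewrite /= /exponential_prob; apply: integral0_eq => z; rewrite /= in_itv/= => z0.
  by rewrite lt0_exponential_pdf.
have -> : [set: R] = `]-oo, 0%R[ `|` (`[0%R, y] `|` `]y, +oo[).
  apply/seteqP; split => // z _; rewrite /= !in_itv/= andbT.
  have [z0|z0] := ltP z 0; first by left.
  by right; have [zy|zy] := leP z y; [left|right].
rewrite ge0_integral_setU//=; first last.
- apply/disj_setPS => z [/=]; rewrite !in_itv/= andbT => z0 [/andP[z0' _]|yz].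
    by move: z0; rewrite ltNge z0'.
  by move: (lt_trans yz z0); rewrite ltNge y0.
- exact: measurable_funTS.
- exact: measurableU.
rewrite neg add0e ge0_integral_setU//=; first last.
- apply/disj_setPS => z [/=]; rewrite !in_itv/= andbT => /andP[_ zy] yz.
  by move: yz; rewrite ltNge zy.
- exact: measurable_funTS.
Qed.

(** A claim larger than y contributes its probability exp(- b y), and the smaller
    claims contribute exp(- s y) - exp(- b y) thanks to the prefactor. *)
Lemma ruin_fun_exp_law (R : realType) (b s y : R) (b0 : 0 < b) :
  s < b -> 0 <= y ->
  (\int[exp_law b0]_z (ruin_fun b s (y - z))%:E = (expR (- s * y))%:E)%E.
Proof.
move=> sb y0.
rewrite (ge0_integral_exp_law_split b0 y0); last 2 first.
- apply/measurable_EFinP; apply: measurableT_comp => //; first exact: measurable_ruin_fun.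
  exact: measurable_funB.
- by move=> z; rewrite lee_fin ruin_fun_ge0.
have -> : (\int[exp_law b0]_(z in `[0%R, y]) (ruin_fun b s (y - z))%:E =
  \int[exp_law b0]_(z in `[0%R, y]) (((b - s) / b * expR (- s * y))%:E * (expR (s * z))%:E))%E.
  apply: eq_integral => z; rewrite inE/= in_itv/= => /andP[z0 zy].
  rewrite /ruin_fun subr_lt0 ltNge zy/= -EFinM -[X in _ = X%:E]mulrA -expRD.
  by congr (_ * expR _)%:E; ring.
rewrite ge0_integralZl//; last 2 first.
- by apply: measurable_funTS; apply/measurable_EFinP; apply: measurableT_comp.
- by rewrite lee_fin mulr_ge0 ?expR_ge0// divr_ge0 ?subr_ge0// ltW.
have -> : (\int[exp_law b0]_(z in `]y, +oo[) (ruin_fun b s (y - z))%:E =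
  \int[exp_law b0]_(z in `]y, +oo[) (cst 1%:E z))%E.
  apply: eq_integral => z; rewrite inE/= in_itv/= andbT => yz.
  by rewrite /ruin_fun subr_lt0 yz.
rewrite truncated_mgf_exponential_prob// integral_cst// mul1e.
rewrite [X in (_ + X)%E](exponential_prob_gt b0 y0) -EFinM -EFinD.
congr EFin.
have bs : b - s != 0 by rewrite subr_eq0 gt_eqF.
have -> : - (b - s) * y = s * y + - b * y by ring.
rewrite mulNr expRN expRD.
by field; rewrite bs !gt_eqF// expR_gt0.
Qed.

(** * One time step *)

(** The quantity bounded here is the probability that a Poisson variable of mean z
    is at least 2. *)
Lemma expR_Dx_defect (R : realType) (z : R) : 0 <= z ->
  0 <= 1 - expR (- z) * (1 + z) <= z ^+ 2.
Proof.
move=> z0; apply/andP; split.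
  by rewrite subr_ge0 expRN mulrC ler_pdivrMr ?expR_gt0// mul1r expR_ge1Dx.
have : (1 - z) * (1 + z) <= expR (- z) * (1 + z).
  by rewrite ler_wpM2r ?expR_ge1Dx// addr_ge0.
lra.
Qed.

Section survival_step.
Context (d : measure_display) (T : measurableType d) (R : realType)
  (P : probability T R) (b L c : R) (Y : nat -> {RV P >-> R})
  (N : R -> {RV P >-> nat}) (x h : R).
Hypotheses (b0 : 0 < b) (L0 : 0 < L) (h0 : 0 < h)
  (indepY : mutually_independent P Y)
  (lawY : forall i, has_exponential_law b (Y i))
  (poissonN : poisson_process L N)
  (indepNY : independent_sigma_algebras P
    (generated_sigma_algebra [set t : R | 0 <= t] N)
    (generated_sigma_algebra [set: nat] Y)).

Let X := grid_risk c Y N x h.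
Let G := survival c Y N x h.
Let J := jumps N h.
Let Z := next_claim Y N h.

Let mX k : measurable_fun [set: T] (X k).
Proof. exact: measurable_risk. Qed.

Let mG k : measurable (G k).
Proof. exact: measurable_survival. Qed.

Let mJ k m : measurable (J k @^-1` [set m]).
Proof. by rewrite -[Y in measurable Y]setTI; exact: measurable_jumps. Qed.

Lemma jumps_law k m : P (J k @^-1` [set m]) = (poisson_pmf (L * h) m)%:E.
Proof.
have := poisson_process_increment_law poissonN (s := h * k%:R) (t := h * k.+1%:R).
rewrite -mulrBr -natrB// subSnn mulr1 => -> //.
- by rewrite mulr_ge0// ltW.
- by rewrite ltr_pM2l// ltr_nat.
Qed.

(** Integrating out the next claim and the number of jumps, both independent of
    the surplus on the survival event. *)
Lemma integral_next_claim k m (F : R * measurableTypeR R -> \bar R) :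
  measurable_fun [set: R * measurableTypeR R] F -> (forall z, 0 <= F z)%E ->
  (\int[P]_(w in G k `&` J k @^-1` [set m]) F (X k w, Z k w) =
   (poisson_pmf (L * h) m)%:E *
   \int[P]_(w in G k) \int[exp_law b0]_y F (X k w, y))%E.
Proof.
move=> mF F0.
pose U : {mfun T >-> R} := HB.pack (X k) (isMeasurableFun.Build _ _ _ _ _ (mX k)).
have mZ : measurable_fun [set: T] (Z k : T -> measurableTypeR R).
  exact: measurable_next_claim.
pose V : {mfun T >-> measurableTypeR R} := HB.pack (Z k) (isMeasurableFun.Build _ _ _ _ _ mZ).
have mA : measurable (G k `&` J k @^-1` [set m]) by exact: measurableI.
have H B1 : measurable B1 -> (P (G k `&` J k @^-1` [set m] `&` X k @^-1` B1) =
    (poisson_pmf (L * h) m)%:E * P (G k `&` X k @^-1` B1))%E.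
  move=> mB1.
  have := grid_independence c x indepY lawY poissonN indepNY h0 k m mB1 measurableT.
  rewrite preimage_setT setIT -/X -/G -/J => ->; rewrite -[exponential_prob b _]/(exp_law b0 setT).
  by rewrite probability_setT mule1 jumps_law.
have := @ge0_integral_indep _ _ _ T _ _ R P (exp_law b0) _ U V F mA _ mF F0.
rewrite /U/V/= => ->.
  apply: (@ge0_integral_scaled_law _ _ T _ R P (poisson_pmf (L * h) m) _ (G k) U
     (fun u => \int[exp_law b0]_y F (u, y))%E) => //.
  - exact: poisson_pmf_ge0.
  - exact: measurable_fun_fubini_tonelli_F.
  - by move=> u; exact: integral_ge0.
move=> B1 B2 mB1 mB2.
rewrite (H _ mB1) (grid_independence c x indepY lawY poissonN indepNY h0 k m mB1 mB2).
by rewrite jumps_law muleAC.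
Qed.

Lemma grid_risk_jumps k m w : J k w = m -> 
  X k.+1 w = X k w + c * h - \sum_(i < m) Y (N (h * k%:R) w + i)%N w.
Proof.
move=> Jm; rewrite /X /grid_risk /risk.
have -> : N (h * k.+1%:R) w = (N (h * k%:R) w + m)%N.
  rewrite -Jm subnKC//; apply: (poisson_process_nondecreasing poissonN).
    by rewrite mulr_ge0// ltW.
  by rewrite ler_pM2l// ler_nat.
rewrite big_split_ord/= -[k.+1]addn1 natrD.
ring.
Qed.

Lemma prob_two_jumps k :
  (P (J k @^-1` [set m | (2 <= m)%N]) <= ((L * h) ^+ 2)%:E)%E.
Proof.
have -> : J k @^-1` [set m | (2 <= m)%N] =
   ~` (J k @^-1` [set 0%N] `|` J k @^-1` [set 1%N]).
  apply/seteqP; split => w /=; first by move=> J2 [] J1; move: J2; rewrite J1.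
  by case: (J k w) => [|[|m]]//= H; exfalso; apply: H; [left|right].
rewrite probability_setC; last exact: measurableU.
have -> : (P (J k @^-1` [set 0%N] `|` J k @^-1` [set 1%N]) =
    P (J k @^-1` [set 0%N]) + P (J k @^-1` [set 1%N]))%E.
  by rewrite measureU//; apply/seteqP; split => w //= [->].
rewrite !jumps_law /poisson_pmf mulr_gt0// -EFinD lee_fin.
rewrite expr0 expr1 factS fact0 muln1 !divr1 mul1r.
have /andP[_] := expR_Dx_defect (ltW (mulr_gt0 L0 h0)); lra.
Qed.

(** One step is split according to the number of claims: none, one, or at least
    two.  The function g is the mean of f after a single claim. *)
Lemma grid_step k (f g : R -> R) :
  measurable_fun [set: R] f -> (forall u, 0 <= f u <= 1) ->
  (forall u, 0 <= u -> (\int[exp_law b0]_y (f (u + c * h - y))%:E = (g u)%:E)%E) ->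
  exists2 e : \bar R, (0 <= e <= ((L * h) ^+ 2)%:E)%E &
  (\int[P]_(w in G k) (f (X k.+1 w))%:E =
   (expR (- (L * h)))%:E * \int[P]_(w in G k) (f (X k w + c * h))%:E
   + (L * h * expR (- (L * h)))%:E * \int[P]_(w in G k) (g (X k w))%:E + e)%E.
Proof.
move=> mf f01 fg.
have f0 u : (0 <= (f u)%:E)%E by rewrite lee_fin; case/andP: (f01 u).
have mfX j : measurable_fun [set: T] (fun w => (f (X j w))%:E).
  by apply/measurable_EFinP; exact: measurableT_comp.
have mJ2 : measurable (J k @^-1` [set m | (2 <= m)%N]).
  by rewrite -[Y in measurable Y]setTI; exact: measurable_jumps.
have mGJ2 : measurable (G k `&` J k @^-1` [set m | (2 <= m)%N]) by exact: measurableI.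
have mGJ m : measurable (G k `&` J k @^-1` [set m]) by exact: measurableI.
exists (\int[P]_(w in G k `&` J k @^-1` [set m | (2 <= m)%N]) (f (X k.+1 w))%:E)%E.
  rewrite integral_ge0//=.
  apply: (@le_trans _ _ (\int[P]_(w in G k `&` J k @^-1` [set m | (2 <= m)%N]) (cst 1%:E w))%E).
    apply: ge0_le_integral; [exact: mGJ2|by move=> w _; exact: f0| | |].
    - exact: (measurable_funTS (mfX k.+1)).
    - exact: measurable_cst.
    - by move=> w _; rewrite lee_fin; case/andP: (f01 (X k.+1 w)).
  rewrite integral_cst ?mul1e; last exact: mGJ2.
  apply: le_trans (prob_two_jumps k).
  by apply: le_measure; rewrite ?inE//; exact: measurableI.
have GE : G k = (G k `&` J k @^-1` [set 0%N]) `|` ((G k `&` J k @^-1` [set 1%N])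
   `|` (G k `&` J k @^-1` [set m | (2 <= m)%N])).
  rewrite -!setIUr -[LHS]setIT; congr (_ `&` _); apply/seteqP; split => // w _ /=.
  by case: (J k w) => [|[|m]]; [left|right; left|right; right].
rewrite {1}GE ge0_integral_setU; first last.
- by apply/disj_setPS => w [[_ /= ->]] [[]|[]].
- by move=> w _; exact: f0.
- exact: (measurable_funTS (mfX k.+1)).
- by apply: measurableU; [exact: mGJ|exact: mGJ2].
- exact: mGJ.
rewrite ge0_integral_setU; first last.
- by apply/disj_setPS => w [[_ /= ->]] [].
- by move=> w _; exact: f0.
- exact: (measurable_funTS (mfX k.+1)).
- exact: mGJ2.
- exact: mGJ.
rewrite addeA; congr (_ + _ + _)%E.
- transitivity (\int[P]_(w in G k `&` J k @^-1` [set 0%N]) (f ((X k w, Z k w).1 + c * h))%:E)%E.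
    apply: eq_integral => w; rewrite inE => -[_ /= J0].
    by rewrite (grid_risk_jumps J0) big_ord0 subr0.
  rewrite (@integral_next_claim k 0%N (fun z => (f (z.1 + c * h))%:E))//; last first.
    apply/measurable_EFinP; apply: measurableT_comp => //.
    by apply: measurable_funD => //; exact: measurable_fst.
  rewrite /poisson_pmf mulr_gt0// expr0 fact0 invr1 !mul1r.
  congr (_ * _)%E; apply: eq_integral => w _ /=.
  by rewrite integral_cst//= [X in (_ * X)%E](probability_setT (exp_law b0)) mule1.
- transitivity (\int[P]_(w in G k `&` J k @^-1` [set 1%N])
     (f ((X k w, Z k w).1 + c * h - (X k w, Z k w).2))%:E)%E.
    apply: eq_integral => w; rewrite inE => -[_ /= J1].
    by rewrite (grid_risk_jumps J1) big_ord1 addn0.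
  rewrite (@integral_next_claim k 1%N (fun z => (f (z.1 + c * h - z.2))%:E))//; last first.
    apply/measurable_EFinP; apply: measurableT_comp => //.
    apply: measurable_funB; last exact: measurable_snd.
    by apply: measurable_funD => //; exact: measurable_fst.
  rewrite /poisson_pmf mulr_gt0// expr1 factS fact0 muln1 divr1.
  congr (_ * _)%E; apply: eq_integral => w; rewrite inE => Gw /=.
  by rewrite fg//; exact: Gw.
Qed.

End survival_step.

(** * The recursion along the grid *)

Section survival_recursion.
Context (d : measure_display) (T : measurableType d) (R : realType)
  (P : probability T R) (b L c : R) (Y : nat -> {RV P >-> R})
  (N : R -> {RV P >-> nat}) (x h : R).
Hypotheses (b0 : 0 < b) (L0 : 0 < L) (c0 : 0 <= c) (h0 : 0 < h)
  (indepY : mutually_independent P Y)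
  (lawY : forall i, has_exponential_law b (Y i))
  (poissonN : poisson_process L N)
  (indepNY : independent_sigma_algebras P
    (generated_sigma_algebra [set t : R | 0 <= t] N)
    (generated_sigma_algebra [set: nat] Y)).

Let X := grid_risk c Y N x h.
Let G := survival c Y N x h.

Definition survival_prob (k : nat) : R := fine (P (G k)).

(** E[ruin_fun(X_k); G_k], the part of the ruin probability not yet realized at
    the k-th grid time. *)
Definition ruin_potential (s : R) (k : nat) : R :=
  fine (\int[P]_(w in G k) (ruin_fun b s (X k w))%:E)%E.

Let mX k : measurable_fun [set: T] (X k).
Proof. exact: measurable_risk. Qed.

Let mG k : measurable (G k).
Proof. exact: measurable_survival. Qed.

Let mfX s j : measurable_fun [set: T] (fun w => (ruin_fun b s (X j w))%:E).
Proof.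
by apply/measurable_EFinP; apply: measurableT_comp => //; exact: measurable_ruin_fun.
Qed.

Let f0 s u : s < b -> (0 <= (ruin_fun b s u)%:E)%E.
Proof. by move=> sb; rewrite lee_fin ruin_fun_ge0. Qed.

Let subG k : G k.+1 `<=` G k.
Proof. by move=> w H i ik; apply: H; rewrite leqW. Qed.

Let int_le1 (s : R) j k : 0 <= s -> s < b ->
  (\int[P]_(w in G k) (ruin_fun b s (X j w))%:E <= 1)%E.
Proof.
move=> s0 sb; apply: (@le_trans _ _ (\int[P]_(w in G k) (cst 1%:E w))%E).
  apply: ge0_le_integral; [exact: mG|by move=> w _; exact: f0| | |].
  - exact: (measurable_funTS (mfX s j)).
  - exact: measurable_cst.
  - by move=> w _; rewrite lee_fin ruin_fun_le1.
by rewrite integral_cst// mul1e probability_le1.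
Qed.

Let int_ge0 s j k : s < b -> (0 <= \int[P]_(w in G k) (ruin_fun b s (X j w))%:E)%E.
Proof. by move=> sb; apply: integral_ge0 => w _; exact: f0. Qed.

Let int_fin (s : R) j k : 0 <= s -> s < b ->
  (\int[P]_(w in G k) (ruin_fun b s (X j w))%:E)%E \is a fin_num.
Proof.
move=> s0 sb; rewrite ge0_fin_numE ?int_ge0//.
by rewrite (le_lt_trans (int_le1 j k s0 sb))// ltry.
Qed.

Lemma ruin_potential_ge0 s k : s < b -> 0 <= ruin_potential s k.
Proof. by move=> sb; rewrite fine_ge0// int_ge0. Qed.

Lemma ruin_potential_le1 (s : R) k : 0 <= s -> s < b -> ruin_potential s k <= 1.
Proof.
move=> s0 sb; rewrite /ruin_potential -[1]/(fine 1%:E) fine_le ?int_fin//.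
exact: int_le1.
Qed.

Lemma survival_probS k : survival_prob k.+1 <= survival_prob k.
Proof.
rewrite /survival_prob fine_le ?fin_num_measure// le_measure ?inE//.
Qed.

Lemma ruin_potential_le (s s' : R) k : 0 <= s -> s <= s' -> s' < b ->
  ruin_potential s' k <= ruin_potential s k.
Proof.
move=> s0 ss' sb; have sb' := le_lt_trans ss' sb.
rewrite /ruin_potential fine_le ?int_fin//; first by rewrite (le_trans s0).
apply: ge0_le_integral; [exact: mG|by move=> w _; exact: f0| | |].
- exact: (measurable_funTS (mfX s' k)).
- exact: (measurable_funTS (mfX s k)).
move=> w _; rewrite lee_fin /ruin_fun; case: ltP => // X0.
rewrite ler_pM ?expR_ge0 ?divr_ge0 ?subr_ge0 ?(ltW b0) ?(ltW sb)//.
  by rewrite ler_pM2r ?invr_gt0// lerD2l lerN2.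
by rewrite ler_expR ler_wpM2r// lerN2.
Qed.

Lemma survival_prob0 : 0 <= x -> survival_prob 0 = 1.
Proof.
move=> x0; rewrite /survival_prob (_ : G 0%N = setT) ?probability_setT//.
apply/seteqP; split => // w _ i; rewrite leqn0 => /eqP ->.
by rewrite /grid_risk /risk mulr0 (poisson_process_start poissonN) big_ord0 subr0 mulr0 addr0.
Qed.

Lemma ruin_potential0 s : 0 <= x -> ruin_potential s 0 = (b - s) / b * expR (- s * x).
Proof.
move=> x0; rewrite /ruin_potential.
have X0 w : X 0%N w = x.
  by rewrite /X /grid_risk /risk mulr0 (poisson_process_start poissonN) big_ord0 subr0 mulr0 addr0.
have -> : G 0%N = setT.
  by apply/seteqP; split => // w _ i; rewrite leqn0 => /eqP ->; rewrite -/X X0.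
under eq_integral do rewrite X0.
by rewrite integral_cst// [X in (_ * X)%E](probability_setT P) mule1/= /ruin_fun ltNge x0.
Qed.

(** On the paths lost at step k+1 the surplus is negative and [ruin_fun] is 1,
    which produces the difference of survival probabilities. *)
Lemma survival_recursion (s : R) k : 0 <= s -> s < b ->
  exists2 e : R, 0 <= e <= (L * h) ^+ 2 &
  ruin_potential s k.+1 + (survival_prob k - survival_prob k.+1) =
  expR (- ((L + s * c) * h)) * (1 + L * h * (b / (b - s))) * ruin_potential s k + e.
Proof.
move=> s0 sb.
have bs : 0 < b - s by rewrite subr_gt0.
have f01 u : 0 <= ruin_fun b s u <= 1 by rewrite ruin_fun_ge0// ruin_fun_le1.
have ch : 0 <= c * h by rewrite mulr_ge0// ltW.
have fg u : 0 <= u -> (\int[exp_law b0]_y (ruin_fun b s (u + c * h - y))%:E =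
    (expR (- s * (u + c * h)))%:E)%E.
  by move=> u0; rewrite ruin_fun_exp_law// addr_ge0.
have [e /andP[e0 eL]] := grid_step x L0 h0 indepY lawY poissonN indepNY k
  (measurable_ruin_fun b s) f01 fg.
have efin : e \is a fin_num by rewrite ge0_fin_numE// (le_lt_trans eL)// ltry.
rewrite -/X -/G.
have -> : (\int[P]_(w in G k) (ruin_fun b s (X k w + c * h))%:E =
    (expR (- s * (c * h)))%:E * \int[P]_(w in G k) (ruin_fun b s (X k w))%:E)%E.
  rewrite -ge0_integralZl; first last.
  - by rewrite lee_fin expR_ge0.
  - by move=> w _; exact: f0.
  - exact: (measurable_funTS (mfX s k)).
  - exact: mG.
  apply: eq_integral => w; rewrite inE => Gw.
  have Xk : 0 <= X k w by exact: Gw.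
  rewrite /ruin_fun !ltNge Xk addr_ge0//= -EFinM mulrDr expRD; congr EFin; ring.
have -> : (\int[P]_(w in G k) (expR (- s * (X k w + c * h)))%:E =
    (b / (b - s) * expR (- s * (c * h)))%:E * \int[P]_(w in G k) (ruin_fun b s (X k w))%:E)%E.
  rewrite -ge0_integralZl; first last.
  - by rewrite lee_fin mulr_ge0 ?expR_ge0// divr_ge0// ltW.
  - by move=> w _; exact: f0.
  - exact: (measurable_funTS (mfX s k)).
  - exact: mG.
  apply: eq_integral => w; rewrite inE => Gw.
  have Xk : 0 <= X k w by exact: Gw.
  rewrite /ruin_fun ltNge Xk /= -EFinM mulrDr expRD; congr EFin.
  by field; rewrite !gt_eqF.
have -> : (\int[P]_(w in G k) (ruin_fun b s (X k.+1 w))%:E =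
    \int[P]_(w in G k.+1) (ruin_fun b s (X k.+1 w))%:E + (P (G k) - P (G k.+1)))%E.
  have GE : G k = G k.+1 `|` (G k `\` G k.+1) by rewrite setDUK//; exact: subG.
  rewrite {1}GE ge0_integral_setU; first last.
  - by apply/disj_setPS => w [] ? [].
  - by move=> w _; exact: f0.
  - exact: (measurable_funTS (mfX s k.+1)).
  - exact: measurableD.
  - exact: mG.
  congr (_ + _)%E.
  transitivity (\int[P]_(w in G k `\` G k.+1) (cst 1%:E w))%E.
    apply: eq_integral => w; rewrite inE => -[Gw nGw].
    rewrite /ruin_fun; case: ltP => // X0; exfalso; apply: nGw => i.
    by rewrite leq_eqVlt => /orP[/eqP -> //|]; rewrite ltnS => ik; exact: Gw.
  rewrite integral_cst ?mul1e; last exact: measurableD.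
  rewrite measureD//; last by rewrite (le_lt_trans (probability_le1 _ _))// ltry.
  by rewrite setIidr//; exact: subG.
move=> E; exists (fine e).
  by rewrite fine_ge0//= -lee_fin fineK.
have := congr1 fine E.
rewrite -(fineK (int_fin k.+1 k.+1 s0 sb)) -(fineK (int_fin k k s0 sb)).
rewrite -(fineK (fin_num_measure P _ (mG k))) -(fineK (fin_num_measure P _ (mG k.+1))).
rewrite -(fineK efin) -!EFinM -!EFinD /= -/(ruin_potential s k.+1) -/(ruin_potential s k).
rewrite -/(survival_prob k) -/(survival_prob k.+1) => ->.
have -> : - ((L + s * c) * h) = - (L * h) + - s * (c * h) by ring.
rewrite expRD; ring.
Qed.

End survival_recursion.

(** * Ruin on the grid *)

Section grid_ruin_estimate.
Context (d : measure_display) (T : measurableType d) (R : realType)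
  (P : probability T R) (b L c : R) (Y : nat -> {RV P >-> R})
  (N : R -> {RV P >-> nat}) (x : R).
Hypotheses (b0 : 0 < b) (L0 : 0 < L) (c0 : 0 < c) (bcL : L < b * c) (x0 : 0 <= x)
  (indepY : mutually_independent P Y)
  (lawY : forall i, has_exponential_law b (Y i))
  (poissonN : poisson_process L N)
  (indepNY : independent_sigma_algebras P
    (generated_sigma_algebra [set t : R | 0 <= t] N)
    (generated_sigma_algebra [set: nat] Y)).

Let r : R := b - L / c.

Let r0 : 0 < r.
Proof. by rewrite subr_gt0 ltr_pdivrMr. Qed.

Let rb : r < b.
Proof. by rewrite ltrBlDr ltrDl divr_gt0. Qed.

(** For s = r the one-step factor is exp(- z) (1 + z) with z = b c h, which differs
    from 1 only at second order. *)
Lemma ruin_potential_balance (h : R) k : 0 < h ->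
  `|(1 - survival_prob c Y N x h k) + ruin_potential b c Y N x h r k
    - L / (b * c) * expR (- r * x)| <= k%:R * ((b * c * h) ^+ 2 + (L * h) ^+ 2).
Proof.
move=> h0; elim: k => [|k IH].
  rewrite (survival_prob0 c Y h poissonN x0) (ruin_potential0 b c Y h poissonN r x0).
  have -> : (b - r) / b = L / (b * c) by rewrite /r; field; rewrite !gt_eqF.
  by rewrite subrr add0r subrr normr0 mul0r.
have [e /andP[e0 eL] E] := survival_recursion x b0 L0 (ltW c0) h0
  indepY lawY poissonN indepNY k (ltW r0) rb.
set v := ruin_potential b c Y N x h r k in IH E *.
set v' := ruin_potential b c Y N x h r k.+1 in E *.
set u := survival_prob c Y N x h k in IH E *.
set u' := survival_prob c Y N x h k.+1 in E *.
set q := expR _ * (1 + _) in E.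
have qE : q = expR (- (b * c * h)) * (1 + b * c * h).
  rewrite /q; have -> : b - r = L / c by rewrite /r opprB addrC subrK.
  have -> : (L + r * c) * h = b * c * h by rewrite /r; field; rewrite gt_eqF.
  by congr (_ * (1 + _)); field; rewrite !gt_eqF.
have := expR_Dx_defect (mulr_ge0 (mulr_ge0 (ltW b0) (ltW c0)) (ltW h0)).
rewrite -qE => /andP[q1 q2].
have v0 : 0 <= v by rewrite ruin_potential_ge0.
have v1 : v <= 1 by rewrite ruin_potential_le1// ltW.
have -> : 1 - u' + v' - L / (b * c) * expR (- r * x) =
  (1 - u + v - L / (b * c) * expR (- r * x)) + (- ((1 - q) * v) + e).
  have -> : v' = q * v + e - (u - u') by rewrite -E addrK.
  ring.
apply: (le_trans (ler_normD _ _)).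
rewrite -natr1 [leRHS]mulrDl mul1r; apply: lerD => //.
apply: (le_trans (ler_normD _ _)).
rewrite normrN (ger0_norm e0) ger0_norm ?mulr_ge0//; apply: lerD => //.
by apply: le_trans q2; rewrite ler_piMr.
Qed.

Let s : R := r / 2.

Let sr : s < r.
Proof. by rewrite /s ltr_pdivrMr// ltr_pMr// ltr1n. Qed.

Let s0 : 0 < s.
Proof. by rewrite /s divr_gt0. Qed.

Let drift : R := s * (c - L / (b - s)).

(** The drift is minus the Lundberg exponent L (b / (b - s) - 1) - c s, a convex
    function of s that is negative strictly between its zeros 0 and r. *)
Lemma drift_gt0 : 0 < drift.
Proof.
rewrite /drift mulr_gt0// subr_gt0 ltr_pdivrMr ?subr_gt0 ?(lt_trans sr)//.
rewrite -ltr_pdivrMl// mulrC ltrBrDr -ltrBrDl; exact: sr.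
Qed.

(** For s = r / 2 the one-step factor is at most exp(- drift * h), and the paths
    lost at this step only decrease the left-hand side. *)
Lemma ruin_potential_decay (h : R) k : 0 < h ->
  ruin_potential b c Y N x h s k <= expR (- (drift * h) * k%:R) + k%:R * (L * h) ^+ 2.
Proof.
move=> h0; have sb : s < b by exact: lt_trans rb.
elim: k => [|k IH].
  rewrite mulr0 mul0r expR0 addr0; apply: ruin_potential_le1 => //; exact: ltW.
have [e /andP[e0 eL] E] := survival_recursion x b0 L0 (ltW c0) h0
  indepY lawY poissonN indepNY k (ltW s0) sb.
have uu := survival_probS c Y N x h k.
set v := ruin_potential b c Y N x h s k in IH E *.
set v' := ruin_potential b c Y N x h s k.+1 in E *.
set q := expR _ * (1 + _) in E.
have q0 : 0 <= q.
  by rewrite /q mulr_ge0 ?expR_ge0// addr_ge0// !mulr_ge0 ?invr_ge0 ?subr_ge0// ltW.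
have qd : q <= expR (- (drift * h)).
  have -> : - (drift * h) = - ((L + s * c) * h) + L * h * (b / (b - s)).
    by rewrite /drift; field; rewrite subr_eq0 gt_eqF.
  by rewrite expRD /q ler_wpM2l ?expR_ge0// expR_ge1Dx.
have d1 : expR (- (drift * h)) <= 1.
  by rewrite expR_le1 oppr_le0 mulr_ge0// ltW// drift_gt0.
have v0 : 0 <= v by rewrite ruin_potential_ge0.
have kL : 0 <= k%:R * (L * h) ^+ 2 by rewrite mulr_ge0// sqr_ge0.
have : v' <= q * v + (L * h) ^+ 2 by lra.
move=> /le_trans; apply.
rewrite -natr1 !mulrDr mulr1 expRD mulrDl mul1r addrA lerD//.
apply: (@le_trans _ _ (expR (- (drift * h)) * (expR (- (drift * h) * k%:R) + k%:R * (L * h) ^+ 2))).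
  by rewrite ler_pM.
by rewrite mulrDr mulrC lerD// ler_piMl.
Qed.

(** Since [ruin_fun] decreases with its exponent, the potential for r is dominated
    by the decaying one for r / 2. *)
Lemma grid_ruin_estimate (h : R) k : 0 < h ->
  `|(1 - survival_prob c Y N x h k) - L / (b * c) * expR (- r * x)| <=
    expR (- (drift * h) * k%:R) + k%:R * ((b * c * h) ^+ 2 + (L * h) ^+ 2 *+ 2).
Proof.
move=> h0.
have H1 := ruin_potential_balance k h0.
have H2 := ruin_potential_decay k h0.
have H3 := ruin_potential_le c Y N x h b0 k (ltW s0) (ltW sr) rb.
have H4 := ruin_potential_ge0 c Y N x h b0 k rb.
set a := L / (b * c) * _ in H1 *.
set w := 1 - _ in H1 *.
set v := ruin_potential _ _ _ _ _ _ r k in H1 H3 H4.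
have -> : w - a = (w + v - a) - v by ring.
apply: (le_trans (ler_normB _ _)); rewrite (ger0_norm H4).
rewrite mulr2n addrA mulrDr; lra.
Qed.

End grid_ruin_estimate.

(** * Ruin in continuous time *)

Section ruin_probability_exponential.
Context (d : measure_display) (T : measurableType d) (R : realType)
  (P : probability T R) (b L c : R) (Y : nat -> {RV P >-> R})
  (N : R -> {RV P >-> nat}) (x : R).
Hypotheses (b0 : 0 < b) (L0 : 0 < L) (c0 : 0 < c) (bcL : L < b * c) (x0 : 0 <= x)
  (indepY : mutually_independent P Y)
  (lawY : forall i, has_exponential_law b (Y i))
  (poissonN : poisson_process L N)
  (indepNY : independent_sigma_algebras P
    (generated_sigma_algebra [set t : R | 0 <= t] N)
    (generated_sigma_algebra [set: nat] Y)).

Let h (p : nat) : R := (4 ^ p)%:R^-1.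

Let h0 p : 0 < h p.
Proof. by rewrite /h invr_gt0 ltr0n expn_gt0. Qed.

Let E (p : nat) : set T := ~` survival c Y N x (h p) (8 ^ p).

Let EP p w : E p w <-> exists2 i, (i <= 8 ^ p)%N & risk c x Y N (h p * i%:R) w < 0.
Proof.
split=> [nG|[i ip Xi] G].
  apply: contrapT => H; apply: nG => i ip; rewrite leNgt; apply/negP => Xi.
  by apply: H; exists i.
by have := G i ip; rewrite leNgt Xi.
Qed.

Let E_nondecreasing : nondecreasing_seq E.
Proof.
apply/nondecreasing_seqP => p; apply/subsetPset => w /EP[i ip Xi].
(* the point i of the grid of mesh 4^-p is the point 4 * i of the next grid *)
apply/EP; exists (4 * i)%N; first by rewrite expnS leq_mul.
rewrite (_ : h p.+1 * _ = h p * i%:R)// /h expnS !natrM.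
by field; rewrite !pnatr_eq0 expn_eq0.
Qed.

Let mE p : measurable (E p).
Proof. by apply: measurableC; exact: measurable_survival. Qed.

Lemma poisson_process_constant_right w (t : R) : 0 <= t ->
  exists2 e : R, 0 < e & forall u, t < u -> u < t + e -> N u w = N t w.
Proof.
move=> t0; have /(_ [set N t w]) := poisson_process_right_continuous poissonN (w := w) t0.
have H : nbhs (N t w) [set N t w] by apply: discrete_set1.
move=> /(_ H) [e /= e0 He]; exists e => // u tu ute.
by apply: He => //=; rewrite distrC ger0_norm ?subr_ge0 ?ltW// ltrBlDl.
Qed.

(** Right continuity keeps the surplus negative for a short time after ruin, and a
    fine enough dyadic grid meets that time interval. *)
Lemma ruin_on_grid :
  [set w | exists2 t, 0 <= t & risk c x Y N t w < 0] = \bigcup_p E p.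
Proof.
apply/seteqP; split => w; last first.
  move=> [p _ /EP[i _ Xi]]; exists (h p * i%:R) => //.
  by rewrite mulr_ge0// ltW.
move=> [t t0 Xt].
have [e e0 He] := poisson_process_constant_right w t0.
(* within e' after t no claim arrives and the premium income is below the deficit *)
pose e' := Num.min e (- risk c x Y N t w / c).
have e'0 : 0 < e' by rewrite lt_min e0 divr_gt0// oppr_gt0.
(* makes the mesh 4^-p smaller than e' and the horizon 2^p larger than t + 1 *)
pose p := (Num.trunc (t + 1 + e'^-1)).+1.
have tp : t + 1 + e'^-1 < p%:R.
  have /trunc_itv/andP[] // : 0 <= t + 1 + e'^-1.
  by rewrite !addr_ge0// invr_ge0 ltW.
have p2 : p%:R <= (2 ^ p)%:R :> R by rewrite ler_nat ltnW// ltn_expl.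
have p24 : (2 ^ p)%:R <= (4 ^ p)%:R :> R by rewrite ler_nat leq_exp2r.
have e'i : 0 < e'^-1 by rewrite invr_gt0.
have he' : h p < e'.
  rewrite /h -[e']invrK ltf_pV2 ?posrE ?ltr0n ?expn_gt0//; lra.
pose i := (Num.trunc (t * (4 ^ p)%:R)).+1.
have /trunc_itv/andP[i1 i2] : 0 <= t * (4 ^ p)%:R by rewrite mulr_ge0.
have q0 : 0 < (4 ^ p)%:R :> R by rewrite ltr0n expn_gt0.
exists p => //; apply/EP; exists i.
  rewrite -(ler_nat R) /i -natr1.
  have -> : (8 ^ p)%N = (2 ^ p * 4 ^ p)%N by rewrite -expnMn.
  rewrite natrM; apply: (@le_trans _ _ ((t + 1) * (4 ^ p)%:R)).
    rewrite mulrDl mul1r lerD// ler1n expn_gt0//.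
  by rewrite ler_pM2r//; lra.
set u := h p * i%:R.
have tu : t < u by rewrite /u /h mulrC ltr_pdivlMr.
have ut : u <= t + h p.
  rewrite /u /h /i -natr1 mulrDr mulr1 lerD2r mulrC ler_pdivrMr//.
have Nu : N u w = N t w.
  apply: He => //; apply: (le_lt_trans ut); rewrite ltrD2l.
  by apply: (lt_le_trans he'); rewrite ge_min lexx.
rewrite /risk Nu -/u.
have : c * (u - t) < - risk c x Y N t w.
  rewrite mulrC -ltr_pdivlMr//; apply: (@le_lt_trans _ _ (h p)).
    by rewrite lerBlDl.
  by apply: (lt_le_trans he'); rewrite ge_min lexx orbT.
rewrite /risk; lra.
Qed.

Lemma cvg_grid_ruin :
  (1 - survival_prob c Y N x (h p) (8 ^ p)) @[p --> \oo] -->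
    L / (b * c) * expR (- (b - L / c) * x).
Proof.
set a := L / (b * c) * _.
have [D D0 HD] : exists2 D, 0 < D & forall p,
    `|(1 - survival_prob c Y N x (h p) (8 ^ p)) - a| <= D / (2 ^ p)%:R.
  have := @grid_ruin_estimate _ T R P b L c Y N x b0 L0 c0 bcL x0 indepY lawY poissonN indepNY.
  have := drift_gt0 L0 c0 bcL.
  set delta := _ * (c - _) => delta0 H.
  exists (delta^-1 + ((b * c) ^+ 2 + L ^+ 2 *+ 2)).
    by rewrite ltr_pwDl ?invr_gt0// addr_ge0 ?mulrn_wge0 ?sqr_ge0.
  move=> p.
  have e8 : (8 ^ p = 2 ^ p * 4 ^ p)%N by rewrite -expnMn.
  have e4 : (4 ^ p = 2 ^ p * 2 ^ p)%N by rewrite -expnMn.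
  apply: (le_trans (H _ _ (h0 p))); rewrite mulrDl; apply: lerD.
    have z0 : 0 < delta * (2 ^ p)%:R by rewrite mulr_gt0// ltr0n expn_gt0.
    have -> : - (delta * h p) * (8 ^ p)%:R = - (delta * (2 ^ p)%:R).
      rewrite /h e8 natrM.
      by field; rewrite pnatr_eq0 expn_eq0.
    rewrite expRN -invfM lef_pV2 ?posrE ?expR_gt0//.
    by apply: le_trans (expR_ge1Dx _); rewrite lerDr.
  rewrite le_eqVlt; apply/orP; left; apply/eqP.
  rewrite /h e8 e4 !natrM.
  by field; rewrite pnatr_eq0 expn_eq0.
apply/cvgrPdist_le => e e0; near=> p.
rewrite distrC; apply: (le_trans (HD p)).
rewrite ler_pdivrMr ?ltr0n ?expn_gt0// -ler_pdivrMl// mulrC.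
apply: (@le_trans _ _ p%:R); last by rewrite ler_nat ltnW// ltn_expl.
near: p; exact: nbhs_infty_ger.
Unshelve. all: by end_near. Qed.

(** The classical formula of Cramer and Lundberg for exponential claims under the
    net profit condition. *)
Theorem exponential_ruin_probability :
  (P [set w | exists2 t, (0 <= t)%R & (risk c x Y N t w < 0)%R] =
   (L / (b * c) * expR (- (b - L / c) * x))%:E)%E.
Proof.
rewrite ruin_on_grid.
have cE : (P \o E) p @[p --> \oo] --> P (\bigcup_p E p).
  by apply: nondecreasing_cvg_mu => //; exact: bigcup_measurable.
have PE p : (P \o E) p = (1 - survival_prob c Y N x (h p) (8 ^ p))%:E.
  rewrite /= /E probability_setC; last exact: measurable_survival.
  by rewrite /survival_prob EFinB fineK// fin_num_measure//; exact: measurable_survival.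
apply: (cvg_unique _ cE) => //.
rewrite (_ : P \o E = fun p => (1 - survival_prob c Y N x (h p) (8 ^ p))%:E); last exact/funext.
by apply: cvg_EFin; [exact: nearW|exact: cvg_grid_ruin].
Qed.

End ruin_probability_exponential.

(** * The scaled model *)

Lemma ruin_time_lty (T : Type) (R : realType) (X : R -> T -> R) (w : T) :
  (ruin_time X w < +oo)%E <-> exists2 t, 0 <= t & X t w < 0.
Proof.
rewrite /ruin_time; split=> [H|[t t0 Xt]].
  apply: contrapT => nex; move: H; rewrite (_ : [set _ | _ in _] = set0) ?ereal_inf0 ?ltxx//.
  by apply/seteqP; split => // y [t [t0 Xt] _]; apply: nex; exists t.
apply: (@le_lt_trans _ _ t%:E); last exact: ltry.
by apply: ereal_inf_lbound; exists t.
Qed.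

Lemma eps_sqrt (R : realType) (n : nat) : eps R n = (Num.sqrt n%:R)^-1.
Proof. by rewrite /eps powRN powR12_sqrt. Qed.

(** Multiplying the surplus by sqrt n turns the claims into Exp(beta) variables,
    the capital into sqrt n * x and the premium rate into
    sqrt n (sqrt n + theta) lambda / beta, which exceeds n lambda / beta. *)
Lemma ruin_probabilityE (d : measure_display) (Omega : measurableType d) (R : realType)
    (P : probability Omega R) (lambda theta beta : R)
    (Y : nat -> {RV P >-> R}) (n : nat) (N : R -> {RV P >-> nat}) (x : R) :
  0 < lambda -> 0 < theta -> 0 < beta -> mutually_independent P Y ->
  (forall i, has_exponential_law beta (Y i)) -> (1 <= n)%N ->
  poisson_process (n%:R * lambda) N ->
  independent_sigma_algebras P
    (generated_sigma_algebra [set t : R | 0 <= t] N)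
    (generated_sigma_algebra [set: nat] Y) ->
  0 <= x ->
  ruin_probability lambda theta Y n N x = g theta beta x (eps R n).
Proof.
move=> l0 th0 b0 indepY lawY n1 poissonN indepNY x0.
have n0 : 0 < n%:R :> R by rewrite ltr0n.
pose q : R := Num.sqrt n%:R.
have q0 : 0 < q by rewrite sqrtr_gt0.
have qq : q * q = n%:R by rewrite -expr2 sqr_sqrtr// ltW.
have cE : premium_rate lambda theta Y n = (q + theta) * lambda / beta.
  by rewrite /premium_rate (mean_exponential b0 (lawY 0%N)).
pose c := q * ((q + theta) * lambda / beta).
have qt0 : 0 < q + theta by rewrite addr_gt0.
have c0 : 0 < c by rewrite /c !mulr_gt0// invr_gt0.
have bcE : beta * c = q * (q + theta) * lambda by rewrite /c; field; rewrite gt_eqF.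
have bcL : n%:R * lambda < beta * c.
  by rewrite bcE -qq ltr_pM2r// ltr_pM2l// ltrDl.
have L0 : 0 < n%:R * lambda by rewrite mulr_gt0.
have qx : 0 <= q * x by rewrite mulr_ge0// ltW.
rewrite /ruin_probability.
have -> : [set w | (ruin_time (surplus lambda theta Y n N x) w < +oo)%E] =
    [set w | exists2 t, 0 <= t & risk c (q * x) Y N t w < 0].
  have sE t w : risk c (q * x) Y N t w = q * surplus lambda theta Y n N x t w.
    rewrite /risk /surplus cE -mulr_suml -/q.
    set S := \sum_(i < _) _; rewrite /c; field; rewrite !gt_eqF//.
  by apply/seteqP; split => w /=; [move=> /ruin_time_lty|move=> H; apply/ruin_time_lty; move: H];
    move=> [t t0 Xt]; exists t => //; move: Xt; rewrite sE pmulr_rlt0.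
rewrite (exponential_ruin_probability b0 L0 c0 bcL qx indepY lawY poissonN indepNY)/=.
have e1 : 1 + theta * (eps R n) = (q + theta) / q.
  by rewrite eps_sqrt -/q; field; rewrite gt_eqF.
rewrite /g e1 bcE -qq; congr (_ * expR _).
  by field; rewrite !gt_eqF.
by rewrite /c; field; rewrite !gt_eqF.
Qed.

Theorem theorem4p2 (R : realType) (lambda theta beta : R)
    (lambda_gt0 : 0 < lambda) (theta_gt0 : 0 < theta) (beta_gt0 : 0 < beta)
    (k : nat) :
  exists C : R, 0 < C /\
    forall (d : measure_display) (Omega : measurableType d)
      (P : probability Omega R) (Y : nat -> {RV P >-> R}),
      mutually_independent P Y ->
      (forall i, has_exponential_law beta (Y i)) ->
    forall n : nat, (1 <= n)%N ->
    forall N : R -> {RV P >-> nat},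
      poisson_process (n%:R * lambda) N ->
      independent_sigma_algebras P
        (generated_sigma_algebra [set t : R | 0 <= t] N)
        (generated_sigma_algebra [set: nat] Y) ->
    forall x : R, 0 <= x ->
      `| ruin_probability lambda theta Y n N x
         - \sum_(m < k.+1) eps R n ^+ m / m`!%:R * dyg theta beta m x 0 |
        <= C * eps R n ^+ k.+1
      /\ C * eps R n ^+ k.+1 = C / n%:R `^ (k.+1%:R / 2).
Proof.
have [M HM] := g_derive_bounded k.+1 theta_gt0 beta_gt0.
exists (`|M| + 1); split; first by rewrite ltr_pwDr.
move=> d Omega P Y indepY lawY n n1 N poissonN indepNY x x0; split; last first.
  congr (_ * _); rewrite /eps -powR_mulrn ?powR_ge0// -powRrM -powRN.
  by congr (_ `^ _); rewrite mulNr mulrC.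
rewrite (ruin_probabilityE lambda_gt0 theta_gt0 beta_gt0 indepY lawY n1 poissonN indepNY x0).
have e0 : 0 <= eps R n by exact: powR_ge0.
have ge0 y : 0 <= y <= eps R n -> 0 <= y by case/andP.
have := @taylor_remainder_le R (fun m => g_derive theta beta m x) k.+1 (`|M| + 1) _ e0 _ _.
rewrite g_derive0 /taylor_poly horner_poly.
have -> : \sum_(m < k.+1) eps R n ^+ m / m`!%:R * dyg theta beta m x 0 =
    \sum_(m < k.+1) g_derive theta beta m x 0 / m`!%:R * eps R n ^+ m.
  apply: eq_bigr => m _; rewrite dygE ?lexx ?ler01//; ring.
apply.
- move=> m y /ge0 y0; apply: is_derive_g_derive.
  by rewrite ltr_pwDl// mulr_ge0// ltW.
- move=> y /ge0 y0; apply: (le_trans (HM _ _ x0 y0)).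
  by apply: (le_trans (ler_norm _)); rewrite lerDl.
Qed.
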